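(* Any closed connected solvable subgroup of $\mathrm{Jonq}$ is conjugate to a subgroup of $\mathrm{PGL}_2(\mathbb C(y))\rtimes\mathrm{Aff}_1$ by an element of $\{1\}\rtimes\mathrm{PGL}_2\subseteq\mathrm{Jonq}$. In particular, any Borel subgroup of $\mathrm{Jonq}$ is conjugate to a Borel subgroup of $\mathrm{PGL}_2(\mathbb C(y))\rtimes\mathrm{Aff}_1$ by an element of $\{1\}\rtimes\mathrm{PGL}_2\subseteq\mathrm{Jonq}$.
   Context: $\mathrm{Bir}(\mathbb P^2)$ is the group of birational transformations of the complex projective plane, identified with $\mathrm{Bir}(\mathbb A^2)$ via $(x,y)\mapsto[x:y:1]$. Zariski topology. For an irreducible complex algebraic variety $A$, a morphism $A\to\mathrm{Bir}(\mathbb P^2)$ is a map $a\mapsto f_a$ arising from an $A$-birational map $f$ of $A\times\mathbb P^2$ that induces an isomorphism $U\to V$ between open subsets $U,V\subseteq A\times \mathbb P^2$ whose projections to $A$ are both surjective, where $f_a$ is $w\dashrightarrow p_2(f(a,w))$ and $p_2$ is the second projection. A subset $F\subseteq\mathrm{Bir}(\mathbb P^2)$ is closed if its preimage under every such morphism (for every $A$) is closed in $A$. ''Connected'' refers to the induced topology. A Borel subgroup of a closed subgroup $G$ of $\mathrm{Bir}(\mathbb P^2)$ is a maximal element among the closed connected solvable subgroups of $G$. $\mathrm{PGL}_2=\mathrm{PGL}_2(\mathbb C)$, $\mathrm{Aff}_1=\mathrm{Aff}_1(\mathbb C)\subseteq \mathrm{PGL}_2$ is the subgroup of maps $y\mapsto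 ay+b$. $\mathrm{Jonq}=\mathrm{PGL}_2(\mathbb C(y))\rtimes\mathrm{PGL}_2$ is the closed subgroup of $\mathrm{Bir}(\mathbb P^2)$ consisting of the maps $(x,y)\dashrightarrow\left(\frac{\alpha(y)x+\beta(y)}{\gamma(y)x+\delta(y)},\frac{ay+b}{cy+d}\right)$ with $\begin{pmatrix}\alpha&\beta\\ \gamma&\delta\end{pmatrix}\in\mathrm{PGL}_2(\mathbb C(y))$, $\begin{pmatrix}a&b\\ c&d\end{pmatrix}\in\mathrm{PGL}_2$; the factor $\mathrm{PGL}_2(\mathbb C(y))$ consists of those maps with second component $y$, and $\{1\}\rtimes\mathrm{PGL}_2$ of those with first component $x$. $\mathrm{PGL}_2(\mathbb C(y))\rtimes\mathrm{Aff}_1$ is the closed subgroup of $\mathrm{Jonq}$ where the second component is $ay+b$. *)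

(* Defs.v *)
From HB Require Import structures.
From mathcomp Require Import all_boot all_order all_algebra.
From mathcomp Require Import boolp classical_sets topology.
From mathcomp Require Import mpoly.

Set Implicit Arguments.
Unset Strict Implicit.
Unset Printing Implicit Defensive.

Import GRing.Theory.

Local Open Scope classical_set_scope.
Local Open Scope ring_scope.
Local Open Scope quotient_scope.

(** Varieties over an algebraically closed field [k] are given by their
    [k]-points together with a finite atlas of affine charts. *)

Section Varieties.
Variable k : closedFieldType.

Definition algebraic n (Z : set 'rV[k]_n) : Prop :=
  exists S : set {mpoly k[n]}, Z = [set v | forall p, S p -> p.@[v 0] = 0].

Record atlas := Atlas {
  point :> Type;
  chart_index : finType;
  chart_dim : chart_index -> nat;
  chart_dom : chart_index -> set point;
  chart : forall i, point -> 'rV[k]_(chart_dim i) }.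
Arguments chart_dom {a} i.
Arguments chart {a} i.

Definition zclosed (X : atlas) (F : set X) : Prop :=
  forall i, exists2 Z, algebraic Z &
    chart_dom i `&` F = chart_dom i `&` chart i @^-1` Z.

Definition zopen (X : atlas) (U : set X) : Prop := zclosed (~` U).

(** [f] restricted to the open set [U] is a morphism of varieties. Near any
    point, [f] stays in any given chart of [Y] around the image, and its
    coordinates are rational functions, put over a common denominator. *)
Definition regular_on (X Y : atlas) (U : set X) (f : X -> Y) : Prop :=
  forall x i j, U x -> chart_dom i x -> chart_dom j (f x) ->
  exists (q : {mpoly k[chart_dim i]})
         (p : 'I_(chart_dim j) -> {mpoly k[chart_dim i]}),
    q.@[chart i x 0] != 0 /\
    forall x', U x' -> chart_dom i x' -> q.@[chart i x' 0] != 0 ->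
      chart_dom j (f x') /\
      forall l, chart j (f x') 0 l = (p l).@[chart i x' 0] / q.@[chart i x' 0].

Definition prod_atlas (X Y : atlas) : atlas :=
  @Atlas (X * Y)%type (chart_index X * chart_index Y)%type
    (fun ij => chart_dim ij.1 + chart_dim ij.2)%N
    (fun ij => chart_dom ij.1 `*` chart_dom ij.2)
    (fun ij z => row_mx (chart ij.1 z.1) (chart ij.2 z.2)).

(** The charts are bijections onto closed subsets of affine spaces; regularity
    of the identity says that overlaps of charts are open and that changes of
    charts are morphisms; the last condition is separatedness. *)
Definition is_variety (X : atlas) : Prop :=
  [/\ \bigcup_i chart_dom (a := X) i = setT,
      forall i : chart_index X, {in chart_dom i &, injective (chart i)},
      forall i : chart_index X, algebraic (chart i @` chart_dom i),
      regular_on [set: X] id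
    & zclosed (X := prod_atlas X X) [set z | z.1 = z.2]].

Definition irreducible (X : atlas) : Prop :=
  [set: X] !=set0 /\
  forall F G : set X, zclosed F -> zclosed G -> F `|` G = setT ->
    F = setT \/ G = setT.

Definition iso_on (X Y : atlas) (U : set X) (V : set Y)
    (f : X -> Y) (g : Y -> X) : Prop :=
  [/\ forall x, U x -> V (f x) /\ g (f x) = x,
      forall y, V y -> U (g y) /\ f (g y) = y,
      regular_on U f & regular_on V g].

(** Points of the projective space are the lines of [k^(n+1)]. *)
Definition proj_point n := {L : {vspace 'rV[k]_n.+1} | \dim L == 1%N}.

Definition hcoord n (L : proj_point n) : 'rV[k]_n.+1 := vpick (val L).

Definition projspace n : atlas :=
  @Atlas (proj_point n) 'I_n.+1 (fun _ => n)
    (fun i => [set L | hcoord L 0 i != 0])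
    (fun i L => \row_l (hcoord L 0 (lift i l) / hcoord L 0 i)).

End Varieties.

Arguments chart_dom {k a} i.
Arguments chart {k a} i.

Section VarietyTheory.
Variable k : closedFieldType.
Implicit Types X Y Z : atlas k.

Definition covered X := forall x : X, exists i, chart_dom i x.

Lemma zopenP X (W : set X) : zopen W <->
  forall x i, W x -> chart_dom i x -> exists2 q : {mpoly k[_]},
    q.@[chart i x 0] != 0 &
    forall x', chart_dom i x' -> q.@[chart i x' 0] != 0 -> W x'.
Proof.
split=> [oW x i Wx ix|oW i].
  have [Z [S ->] E] := oW i.
  have : ~ (chart_dom i `&` chart i @^-1` [set v | forall p, S p -> p.@[v 0] = 0]) x.
    by rewrite -E => -[_ /(_ Wx)].
  move=> nx; have /existsNP[q /not_implyP[Sq qx]] :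
    ~ forall p, S p -> p.@[chart i x 0] = 0 by move=> h; apply: nx; split.
  exists q; first exact/eqP.
  move=> x' ix' qx'; apply: contrapT => nW.
  have : (chart_dom i `&` ~` W) x' by [].
  by rewrite E => -[_ /(_ _ Sq)] /eqP; apply/negP.
pose S := [set q : {mpoly k[_]} |
  forall x', chart_dom i x' -> q.@[chart i x' 0] != 0 -> W x'].
exists [set v | forall p, S p -> p.@[v 0] = 0]; first by exists S.
apply/seteqP; split=> x [ix Hx]; split=> //.
  move=> p Sp; apply/eqP/negPn/negP => px; exact: Hx (Sp _ ix px).
by move=> Wx; have [q qx Sq] := oW _ _ Wx ix; move/eqP: qx; apply; exact: Hx.
Qed.

Lemma zopenT X : zopen [set: X].
Proof. by apply/zopenP=> x i _ _; exists 1; rewrite ?meval1 ?oner_neq0. Qed.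

Lemma zopenI X (V W : set X) : zopen V -> zopen W -> zopen (V `&` W).
Proof.
move=> /zopenP oV /zopenP oW; apply/zopenP => x i [Vx Wx] ix.
have [p px hp] := oV _ _ Vx ix; have [q qx hq] := oW _ _ Wx ix.
exists (p * q) => [|x' ix']; rewrite mevalM mulf_eq0 negb_or ?px //.
by case/andP=> ? ?; split; [exact: hp|exact: hq].
Qed.

Lemma zopen_bigcup X I (D : set I) (V : I -> set X) :
  (forall i, D i -> zopen (V i)) -> zopen (\bigcup_(i in D) V i).
Proof.
move=> oV; apply/zopenP => x i [t Dt Vx] ix.
have /zopenP/(_ _ _ Vx ix)[q qx hq] := oV _ Dt.
by exists q => // x' ix' qx'; exists t => //; exact: hq.
Qed.

Lemma meval_subst n m (p : {mpoly k[n]}) (a : 'I_n -> {mpoly k[m]})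
    (b : {mpoly k[m]}) d : (msize p <= d)%N ->
  exists h : {mpoly k[m]}, forall v, b.@[v] != 0 ->
    p.@[fun l => (a l).@[v] / b.@[v]] = h.@[v] / b.@[v] ^+ d.
Proof.
move=> pd; exists (\sum_(u <- msupp p)
  p@_u *: ((\prod_l a l ^+ u l) * b ^+ (d - mdeg u))) => v b0.
rewrite mevalE raddf_sum /= mulr_suml !big_seq; apply: eq_bigr => u up.
rewrite mevalZ mevalM rmorph_prod /= rmorphXn /= -!mulrA; congr (_ * _).
under eq_bigr do rewrite expr_div_n.
rewrite big_split /=; congr (_ * _).
  by apply: eq_bigr => l _; rewrite rmorphXn.
rewrite prodfV -expr_sum -mdegE.
have ud : (mdeg u <= d)%N by apply: leq_trans pd; apply/ltnW/msize_mdeg_lt.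
by rewrite -[in _ ^+ d](subnK ud) exprD invfM mulrA divff ?mul1r // expf_neq0.
Qed.

Lemma regular_sub X Y (U V : set X) (f : X -> Y) :
  V `<=` U -> regular_on U f -> regular_on V f.
Proof.
move=> VU rf x i j Vx ix jx.
have [q [p [qx H]]] := rf x i j (VU _ Vx) ix jx.
by exists q, p; split=> // x' /VU; exact: H.
Qed.

Lemma regular_comp X Y Z (U : set X) (V : set Y) (f : X -> Y) (g : Y -> Z) :
  covered Y -> (forall x, U x -> V (f x)) ->
  regular_on U f -> regular_on V g -> regular_on U (g \o f).
Proof.
move=> cY UV rf rg x i j Ux ix jx.
have [m mfx] := cY (f x).
have [q1 [p1 [q1x H1]]] := rf _ _ _ Ux ix mfx.
have [q2 [p2 [q2x H2]]] := rg _ _ _ (UV _ Ux) mfx jx.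
pose D := maxn (msize q2) (\max_l msize (p2 l)).
have [h hE] := meval_subst (n := chart_dim m) p1 q1 (leq_maxl _ _ : (msize q2 <= D)%N).
have lD l : (msize (p2 l) <= D)%N.
  by rewrite leq_max (leq_bigmax (F := fun l => msize (p2 l)) l) orbT.
have /choice[hl hlE] : forall l, exists hl : {mpoly k[_]}, forall v,
    q1.@[v] != 0 ->
    (p2 l).@[fun l => (p1 l).@[v] / q1.@[v]] = hl.@[v] / q1.@[v] ^+ D.
  by move=> l; exact: meval_subst.
have fE x' p : U x' -> chart_dom i x' -> q1.@[chart i x' 0] != 0 ->
    p.@[chart m (f x') 0] =
    p.@[fun l => (p1 l).@[chart i x' 0] / q1.@[chart i x' 0]].
  by move=> Ux' ix' /(H1 _ Ux' ix')[_ e]; exact: meval_eq.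
exists (q1 * h), (fun l => q1 * hl l).
have nz x' : U x' -> chart_dom i x' -> (q1 * h).@[chart i x' 0] != 0 <->
    q1.@[chart i x' 0] != 0 /\ q2.@[chart m (f x') 0] != 0.
  move=> Ux' ix'; rewrite mevalM mulf_eq0 negb_or.
  have [q10|q10] := eqVneq (q1.@[chart i x' 0]) 0; first by split=> // -[].
  rewrite fE // hE // mulf_eq0 invr_eq0 expf_eq0 (negPf q10) andbF orbF /=.
  by split=> [|[]].
split=> [|x' Ux' ix' /(nz _ Ux' ix')[q1x' q2x']]; first by apply/nz.
have [mx' _] := H1 _ Ux' ix' q1x'.
have [jx' gE] := H2 _ (UV _ Ux') mx' q2x'.
split=> // l; rewrite gE !fE // hE // hlE // !mevalM.
by rewrite invf_div mulrA divfK ?expf_neq0 // -[RHS]mulf_div divff // mul1r.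
Qed.

Lemma zopen_preimage X Y (U : set X) (O : set Y) (f : X -> Y) :
  covered Y -> zopen U -> regular_on U f -> zopen O -> zopen (U `&` f @^-1` O).
Proof.
move=> cY oU rf /zopenP oO; apply/zopenP => x i [Ux Ox] ix.
have /zopenP/(_ _ _ Ux ix)[r rx hr] := oU.
have [m mfx] := cY (f x).
have [q1 [p1 [q1x H1]]] := rf _ _ _ Ux ix mfx.
have [q2 q2x H2] := oO _ _ Ox mfx.
have [h hE] := meval_subst (n := chart_dim m) p1 q1 (leqnn (msize q2)).
have fE x' p : U x' -> chart_dom i x' -> q1.@[chart i x' 0] != 0 ->
    p.@[chart m (f x') 0] =
    p.@[fun l => (p1 l).@[chart i x' 0] / q1.@[chart i x' 0]].
  by move=> Ux' ix' /(H1 _ Ux' ix')[_ e]; exact: meval_eq.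
exists (r * q1 * h) => [|x' ix']; rewrite !mevalM.
  rewrite !mulf_neq0 //; apply: contra q2x => /eqP h0.
  by rewrite fE // hE // h0 mul0r.
rewrite !mulf_eq0 !negb_or => /andP[/andP[rx' q1x'] hx'].
have Ux' := hr _ ix' rx'; have [mx' _] := H1 _ Ux' ix' q1x'.
split=> //; apply: H2 => //.
by rewrite fE // hE // mulf_neq0 // invr_neq0 // expf_neq0.
Qed.

Lemma meval_neq0_meet n (p q : {mpoly k[n]}) (v w : 'I_n -> k) :
  p.@[v] != 0 -> q.@[w] != 0 -> exists u, p.@[u] != 0 /\ q.@[u] != 0.
Proof.
move=> pv qw.
pose L i : {poly k} := (v i)%:P + (w i - v i) *: 'X.
have line (r : {mpoly k[n]}) :
    exists R : {poly k}, forall t, R.[t] = r.@[fun i => (L i).[t]].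
  exists (\sum_(m <- msupp r) r@_m *: \prod_i L i ^+ m i) => t.
  rewrite horner_sum mevalE; apply: eq_bigr => m _; rewrite hornerZ horner_prod.
  by congr (_ * _); apply: eq_bigr => i _; rewrite horner_exp.
have [P PE] := line p; have [Q QE] := line q.
have P0 : P != 0.
  apply: contraNneq pv => P0; have := PE 0; rewrite P0 horner0 => E.
  by rewrite (_ : p.@[v] = 0) // E; apply: meval_eq => i; rewrite !hornerE.
have Q0 : Q != 0.
  apply: contraNneq qw => Q0; have := QE 1; rewrite Q0 horner0 => E.
  rewrite (_ : q.@[w] = 0) // E; apply: meval_eq => i.
  by rewrite hornerD hornerC hornerZ hornerX mulr1 subrKC.
have /closed_nonrootP[t] : P * Q != 0 by rewrite mulf_neq0.
rewrite rootM negb_or /root PE QE => /andP[? ?].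
by exists (fun i => (L i).[t]).
Qed.

End VarietyTheory.

Section ProjectiveSpace.
Variables (k : closedFieldType) (n : nat).
Local Notation P := (projspace k n).

Lemma hcoord_neq0 (L : P) : hcoord L != 0.
Proof. by rewrite /hcoord vpick0 -dimv_eq0; case: L => L /= /eqP ->. Qed.

Lemma rV_neq0 (v : 'rV[k]_n.+1) : v != 0 -> exists i, v 0 i != 0.
Proof.
move=> v0; apply: contrapT => h; move/eqP: v0; apply; apply/rowP=> i.
by rewrite mxE; apply/eqP/negPn/negP => vi; apply: h; exists i.
Qed.

Lemma projspace_covered : covered P.
Proof. by move=> L; exact: rV_neq0 (hcoord_neq0 L). Qed.

Lemma hline_subproof (v : 'rV[k]_n.+1) : v != 0 -> \dim <[v]>%VS == 1%N.
Proof. by move=> v0; rewrite dim_vline v0. Qed.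

(** The point with homogeneous coordinates [v]. *)
Definition hline (v : 'rV[k]_n.+1) (v0 : v != 0) : P :=
  exist _ <[v]>%VS (hline_subproof v0).

Lemma hcoord_hline (v : 'rV[k]_n.+1) (v0 : v != 0) :
  exists2 c, c != 0 & hcoord (hline v0) = c *: v.
Proof.
have /vlineP[c E] : hcoord (hline v0) \in <[v]>%VS by exact: memv_pick.
exists c => //; apply: contraNneq (hcoord_neq0 (hline v0)) => c0.
by rewrite E c0 scale0r.
Qed.

Lemma regular_projspace_id : regular_on [set: P] id.
Proof.
move=> x i j _ ix jx.
pose H m : {mpoly k[n]} := if unlift i m is Some l then 'X_l else 1.
have HE (y : P) m : hcoord y 0 i != 0 ->
    (H m).@[chart (a := P) i y 0] = hcoord y 0 m / hcoord y 0 i.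
  move=> yi; rewrite /H; case: unliftP => [l|] ->; first by rewrite mevalXU mxE.
  by rewrite meval1 divff.
exists (H j), (fun l => H (lift j l)); split=> [|y _ iy].
  by rewrite HE // mulf_neq0 // invr_neq0.
rewrite HE // mulf_eq0 invr_eq0 (negPf iy) orbF => jy; split=> // l.
by rewrite !HE // mxE invf_div mulrA divfK.
Qed.

Lemma zopen_hpoly (W : set P) : zopen W -> W !=set0 ->
  exists h : {mpoly k[n.+1]}, (exists v, h.@[v] != 0) /\
    forall (v : 'rV[k]_n.+1) (v0 : v != 0), h.@[v 0] != 0 -> W (hline v0).
Proof.
move=> /zopenP oW [L WL]; have [i iL] := projspace_covered L.
have [q qL hq] := oW _ _ WL iL.
have [h2 h2E] : exists h2 : {mpoly k[n.+1]}, forall v : 'rV[k]_n.+1, v 0 i != 0 ->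
    q.@[fun l : 'I_n => v 0 (lift i l) / v 0 i] = h2.@[v 0] / v 0 i ^+ msize q.
  have [h2 h2E] := meval_subst (fun l : 'I_n => 'X_(lift i l)) 'X_i
    (leqnn (msize q)).
  exists h2 => v vi; have := h2E (v 0); rewrite mevalXU => /(_ vi) <-.
  by apply: meval_eq => l; rewrite !mevalXU.
exists ('X_i * h2); split.
  exists (hcoord L 0); rewrite mevalM mevalXU mulf_neq0 //.
  apply: contraNneq qL => h0; rewrite (_ : q.@[_] =
    q.@[fun l : 'I_n => hcoord L 0 (lift i l) / hcoord L 0 i]).
    by rewrite h2E // h0 mul0r.
  by apply: meval_eq => l; rewrite mxE.
move=> v v0; rewrite mevalM mevalXU mulf_eq0 negb_or => /andP[vi hv].
have [c c0 cE] := hcoord_hline v0.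
apply: hq; first by rewrite /= cE mxE mulf_neq0.
rewrite (_ : q.@[_] = q.@[fun l : 'I_n => v 0 (lift i l) / v 0 i]).
  by rewrite h2E // mulf_neq0 // invr_neq0 // expf_neq0.
by apply: meval_eq => l; rewrite mxE cE !mxE -mulf_div divff // mul1r.
Qed.

Lemma projspace_meet (V W : set P) : zopen V -> zopen W ->
  V !=set0 -> W !=set0 -> V `&` W !=set0.
Proof.
move=> oV oW V0 W0.
have [h [[v hv] H]] := zopen_hpoly oV V0.
have [g [[w gw] G]] := zopen_hpoly oW W0.
pose X : {mpoly k[n.+1]} := 'X_ord0.
have [w' [gw' w'0]] : exists u, g.@[u] != 0 /\ X.@[u] != 0.
  by apply: (meval_neq0_meet (w := fun=> 1) gw); rewrite mevalXU oner_neq0.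
have [u [hu]] : exists u, h.@[u] != 0 /\ (g * X).@[u] != 0.
  by apply: (meval_neq0_meet (w := w') hv); rewrite mevalM mulf_neq0.
rewrite mevalM mevalXU mulf_eq0 negb_or => /andP[gu u0].
pose r : 'rV[k]_n.+1 := \row_i u i.
have rE p : p.@[r 0] = p.@[u] by apply: meval_eq => i; rewrite mxE.
have r0 : r != 0.
  by apply: contraNneq u0 => /rowP/(_ ord0); rewrite !mxE => ->.
by exists (hline r0); split; [apply: H|apply: G]; rewrite rE.
Qed.

End ProjectiveSpace.

Lemma projspace_variety (k : closedFieldType) n : is_variety (projspace k n).
Proof.
pose P := projspace k n.
have vT m : algebraic [set: 'rV[k]_m].
  by exists set0; apply/seteqP; split=> // v _ p [].
have eqL (L M : P) (c : k) : c != 0 -> hcoord L = c *: hcoord M -> L = M.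
  move=> c0 e; apply: val_inj.
  have vE (N : P) : val N = <[hcoord N]>%VS.
    apply/esym/eqP; rewrite eqEdim (eqP (valP N)) dim_vline hcoord_neq0 andbT.
    by rewrite -memvE memv_pick.
  rewrite !vE e; apply/eqP; rewrite eqEsubv; apply/andP; split; rewrite -memvE.
    by apply: memvZ; exact: memv_line.
  by rewrite -[X in X \in _](scalerK c0); apply: memvZ; exact: memv_line.
split.
- by apply/seteqP; split=> // L _; have [i iL] := projspace_covered L; exists i.
- move=> i L M; rewrite !inE /= => iL iM /rowP E.
  apply: (@eqL _ _ (hcoord L 0 i / hcoord M 0 i)); first by rewrite mulf_neq0 ?invr_neq0.
  apply/rowP => m; rewrite !mxE.
  case: (unliftP i m) => [l|] ->; last by rewrite divfK.
  have := E l; rewrite !mxE => e.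
  by rewrite mulrAC -[in RHS]mulrA -e mulrC divfK.
- move=> i; rewrite (_ : _ @` _ = setT) //; apply/seteqP; split=> // v _.
  pose w : 'rV[k]_n.+1 := \row_m (if unlift i m is Some l then v 0 l else 1).
  have wi : w 0 i = 1 by rewrite mxE unlift_none.
  have w0 : w != 0 by apply: contraTneq (oner_neq0 k) => w0; rewrite -wi w0 mxE negbK.
  have [c c0 cE] := hcoord_hline w0.
  exists (hline w0); first by rewrite /= cE mxE wi mulr1.
  by apply/rowP=> l; rewrite /= !mxE cE !mxE unlift_none liftK mulr1 mulrC mulKf.
- exact: regular_projspace_id.
- move=> [i j].
  pose Hi m : {mpoly k[n + n]} :=
    if unlift i m is Some l then 'X_(lshift n l) else 1.
  pose Hj m : {mpoly k[n + n]} :=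
    if unlift j m is Some l then 'X_(rshift n l) else 1.
  exists [set v | forall p, (exists a b, p = Hi a * Hj b - Hi b * Hj a) -> p.@[v 0] = 0].
    by exists [set p | exists a b, p = Hi a * Hj b - Hi b * Hj a].
  have HiE (L M : P) m : hcoord L 0 i != 0 ->
     (Hi m).@[chart (a := prod_atlas P P) (i, j) (L, M) 0] = hcoord L 0 m / hcoord L 0 i.
    move=> iL; rewrite /Hi; case: unliftP => [l|] ->.
      by rewrite mevalXU /= row_mxEl mxE.
    by rewrite meval1 divff.
  have HjE (L M : P) m : hcoord M 0 j != 0 ->
     (Hj m).@[chart (a := prod_atlas P P) (i, j) (L, M) 0] = hcoord M 0 m / hcoord M 0 j.
    move=> iL; rewrite /Hj; case: unliftP => [l|] ->.
      by rewrite mevalXU /= row_mxEr mxE.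
    by rewrite meval1 divff.
  apply/seteqP; split=> -[L M] /= [[/= iL jM] H]; split=> //.
    move=> p [a [b ->]]; rewrite -H in jM *.
    rewrite mevalB !mevalM !HiE // !HjE //.
    by rewrite mulrACA [X in _ - X]mulrACA [X in X * _ - _]mulrC subrr.
  have {}H a b : hcoord L 0 a * hcoord M 0 b = hcoord L 0 b * hcoord M 0 a.
    have := H _ (ex_intro _ a (ex_intro _ b erefl)).
    rewrite mevalB !mevalM !HiE // !HjE // => /eqP; rewrite subr_eq0 => /eqP.
    rewrite mulrACA [RHS]mulrACA => /mulIf; apply.
    by rewrite mulf_neq0 ?invr_neq0.
  have jL : hcoord L 0 j != 0.
    apply: contraNneq iL => jL; have := H i j; rewrite jL mul0r => /eqP.
    by rewrite mulf_eq0 (negPf jM) orbF.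
  apply: (@eqL _ _ (hcoord L 0 j / hcoord M 0 j)).
    by rewrite mulf_neq0 ?invr_neq0.
  apply/rowP=> m; rewrite !mxE mulrAC; apply: (canRL (mulfK jM)).
  by rewrite H.
Qed.

Section BirationalMaps.
Variable k : closedFieldType.
Local Notation P2 := (projspace k 2).

(** A birational transformation of [P2] is presented by an isomorphism between
    two nonempty open subsets; two presentations are identified when they
    coincide on a nonempty open subset. *)
Record birep := Birep {
  bdom : set P2;
  bcod : set P2;
  bfun :> P2 -> P2;
  binv : P2 -> P2;
  bdom_open : zopen bdom;
  bcod_open : zopen bcod;
  bdom_neq0 : bdom !=set0;
  birep_iso : iso_on bdom bcod bfun binv }.

HB.instance Definition _ := gen_eqMixin birep.
HB.instance Definition _ := gen_choiceMixin birep.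

Definition bir_agree (r s : birep) : Prop :=
  exists W : set P2, [/\ zopen W, W !=set0, W `<=` bdom r `&` bdom s
    & forall w, W w -> r w = s w].

Lemma bdomK r x : bdom r x -> bcod r (r x) /\ binv r (r x) = x.
Proof. by case: (birep_iso r) => H _ _ _ /H. Qed.

Lemma bcodK r y : bcod r y -> bdom r (binv r y) /\ r (binv r y) = y.
Proof. by case: (birep_iso r) => _ H _ _ /H. Qed.

Lemma bir_agree_dom r s :
  (forall w, bdom r w -> bdom s w -> r w = s w) -> bir_agree r s.
Proof.
move=> H; exists (bdom r `&` bdom s).
split=> // [||w []]; [|apply: projspace_meet|exact: H];
  by [apply: zopenI; exact: bdom_open|exact: bdom_open|exact: bdom_neq0].
Qed.

Lemma bir_agree_refl r : bir_agree r r.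
Proof. exact: bir_agree_dom. Qed.

Lemma bir_agree_sym r s : bir_agree r s -> bir_agree s r.
Proof.
by move=> [W [oW W0 WD H]]; exists W; split=> // [w /WD[]//|w /H->].
Qed.

Lemma bir_agree_trans s r t : bir_agree r s -> bir_agree s t -> bir_agree r t.
Proof.
move=> [V [oV V0 VD HV]] [W [oW W0 WD HW]]; exists (V `&` W); split.
- exact: zopenI.
- exact: projspace_meet.
- by move=> w [/VD[? _] /WD[]].
- by move=> w [/HV-> /HW].
Qed.

Definition bir_agreeb (r s : birep) : bool := `[< bir_agree r s >].

Lemma bir_agreeb_equiv : equiv_class_of bir_agreeb.
Proof.
split=> [r|r s|s r t]; rewrite /bir_agreeb.
- exact/asboolP/bir_agree_refl.
- by apply: asbool_equiv_eq; split; exact: bir_agree_sym.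
- by move=> /asboolP rs /asboolP st; apply/asboolP; exact: bir_agree_trans rs st.
Qed.

Canonical bir_agreeb_rel := EquivRelPack bir_agreeb_equiv.

Definition Bir := {eq_quot bir_agreeb}.
HB.instance Definition _ := Choice.on Bir.
HB.instance Definition _ : EqQuotient birep bir_agreeb Bir := EqQuotient.on Bir.

Lemma bir_eqP r s : \pi_Bir r = \pi_Bir s <-> bir_agree r s.
Proof. by split=> [/eqmodP/asboolP//|rs]; apply/eqmodP/asboolP. Qed.

Lemma bir_reprK r : bir_agree (repr (\pi_Bir r)) r.
Proof. by apply/bir_eqP; rewrite reprK. Qed.

Let cP : covered P2 := @projspace_covered k 2.

Section Comp.
Variables r s : birep.

Let D := bdom s `&` s @^-1` bdom r.
Let E := bcod r `&` binv r @^-1` bcod s.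

Lemma bcomp_dom_open : zopen D.
Proof.
by apply: zopen_preimage; rewrite ?cP; [exact: cP|exact: bdom_open|
  case: (birep_iso s)|exact: bdom_open].
Qed.

Lemma bcomp_cod_open : zopen E.
Proof.
by apply: zopen_preimage; [exact: cP|exact: bcod_open|
  case: (birep_iso r)|exact: bcod_open].
Qed.

Lemma bcod_meet (W : set P2) : zopen W -> W !=set0 ->
  bdom s `&` s @^-1` W !=set0.
Proof.
move=> oW W0; have [|y [sy Wy]] := projspace_meet (bcod_open s) oW _ W0.
  by have [x /bdomK[? _]] := bdom_neq0 s; exists (s x).
by have [dx e] := bcodK sy; exists (binv s y); split=> //=; rewrite e.
Qed.

Lemma bcomp_iso : iso_on D E (r \o s) (binv s \o binv r).
Proof.
have [s1 s2 s3 s4] := birep_iso s; have [r1 r2 r3 r4] := birep_iso r.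
split.
- move=> x [/s1[sx sK] /r1[rx rK]] /=.
  by split; [split=> //=; rewrite rK|rewrite rK].
- move=> y [/r2[rx rK] /s2[sx sK]] /=.
  by split; [split=> //=; rewrite sK|rewrite sK].
- apply: (regular_comp cP (V := bdom r)) => //; first by move=> x [].
  by apply: regular_sub s3 => x [].
- apply: (regular_comp cP (V := bcod s)) => //; first by move=> x [].
  by apply: regular_sub r4 => x [].
Qed.

Definition birep_comp : birep :=
  Birep bcomp_dom_open bcomp_cod_open
    (bcod_meet (bdom_open r) (bdom_neq0 r)) bcomp_iso.

End Comp.

Lemma bir_id_iso : iso_on [set: P2] [set: P2] id id.
Proof. by split=> //; exact: regular_projspace_id. Qed.

Lemma projspace_setT_neq0 : [set: P2] !=set0.
Proof.
have e : delta_mx 0 0 != 0 :> 'rV[k]_3.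
  by apply/eqP => /rowP/(_ 0); rewrite !mxE eqxx => /eqP; rewrite oner_eq0.
by exists (hline e).
Qed.

Definition birep_id : birep :=
  Birep (@zopenT k P2) (@zopenT k P2) projspace_setT_neq0 bir_id_iso.

Lemma bcod_neq0 r : bcod r !=set0.
Proof. by have [x /bdomK[? _]] := bdom_neq0 r; exists (r x). Qed.

Lemma bir_inv_iso r : iso_on (bcod r) (bdom r) (binv r) r.
Proof. by case: (birep_iso r). Qed.

Definition birep_inv r : birep :=
  Birep (bcod_open r) (bdom_open r) (bcod_neq0 r) (bir_inv_iso r).

Lemma birep_comp_agree r r' s s' : bir_agree r r' -> bir_agree s s' ->
  bir_agree (birep_comp r s) (birep_comp r' s').
Proof.
move=> [V [oV V0 VD HV]] [W [oW W0 WD HW]].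
have oS : zopen (bdom s `&` s @^-1` V).
  by apply: zopen_preimage => //; [exact: bdom_open|case: (birep_iso s)].
exists ((bdom s `&` s @^-1` V) `&` W); split.
- exact: zopenI.
- by apply: projspace_meet => //; exact: bcod_meet.
- move=> w [[sw Vsw] Ww]; have [_ s'w] := WD _ Ww; have [rw r'w] := VD _ Vsw.
  by split; split=> //=; rewrite -HW.
- by move=> w [[sw Vsw] Ww] /=; rewrite -HW // HV.
Qed.

Lemma birep_inv_agree r s : bir_agree r s ->
  bir_agree (birep_inv r) (birep_inv s).
Proof.
move=> [W [oW [x Wx] WD HW]]; exists (bcod r `&` binv r @^-1` W); split.
- by apply: zopen_preimage => //; [exact: bcod_open|case: (birep_iso r)].
- by have [/bdomK[rx e] _] := WD _ Wx; exists (r x); split=> //=; rewrite e.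
- move=> y [ry Wy]; split=> //=; have [_ /bdomK[sy _]] := WD _ Wy.
  by move: sy; rewrite -HW //; have [_ ->] := bcodK ry.
- move=> y [ry Wy] /=; have [_ /bdomK[_ e]] := WD _ Wy.
  by rewrite -[LHS]e -HW //; have [_ ->] := bcodK ry.
Qed.

Definition bir_mul (b c : Bir) : Bir := \pi_Bir (birep_comp (repr b) (repr c)).
Definition bir_one : Bir := \pi_Bir birep_id.
Definition bir_inv (b : Bir) : Bir := \pi_Bir (birep_inv (repr b)).

Lemma bir_mulE r s : bir_mul (\pi_Bir r) (\pi_Bir s) = \pi_Bir (birep_comp r s).
Proof. by apply/bir_eqP/birep_comp_agree; exact: bir_reprK. Qed.

Lemma bir_invE r : bir_inv (\pi_Bir r) = \pi_Bir (birep_inv r).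
Proof. by apply/bir_eqP/birep_inv_agree; exact: bir_reprK. Qed.

Fact bir_mulA : associative bir_mul.
Proof.
elim/quotW=> a; elim/quotW=> b; elim/quotW=> c.
rewrite (bir_mulE b c) (bir_mulE a b) !bir_mulE.
by apply/bir_eqP/bir_agree_dom.
Qed.

Fact bir_mul1g : left_id bir_one bir_mul.
Proof.
elim/quotW=> a; rewrite bir_mulE.
by apply/bir_eqP/bir_agree_dom.
Qed.

Fact bir_mulg1 : right_id bir_one bir_mul.
Proof.
elim/quotW=> a; rewrite bir_mulE.
by apply/bir_eqP/bir_agree_dom.
Qed.

Fact bir_mulVg : left_inverse bir_one bir_inv bir_mul.
Proof.
elim/quotW=> a; rewrite bir_invE bir_mulE.
by apply/bir_eqP/bir_agree_dom => w [/bdomK[]].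
Qed.

Fact bir_mulgV : right_inverse bir_one bir_inv bir_mul.
Proof.
elim/quotW=> a; rewrite bir_invE bir_mulE.
by apply/bir_eqP/bir_agree_dom => w [/bcodK[]].
Qed.

(** The product [b * c] is the composition of [c] followed by [b]. *)
HB.instance Definition _ := isGroup.Build Bir
  bir_mulA bir_mul1g bir_mulg1 bir_mulVg bir_mulgV.

(** [b] is the class of the partial map [h] restricted to [D]. *)
Definition bir_class_of (b : Bir) (D : set P2) (h : P2 -> P2) : Prop :=
  exists W : set P2, [/\ zopen W, W !=set0, W `<=` bdom (repr b) `&` D
    & forall w, W w -> repr b w = h w].

(** Since [A] and [P2] are irreducible, the nonempty open sets [U] and [V] are
    dense, and the isomorphism [f] over [A] between them determines an
    [A]-birational map of [A * P2]. *)
Definition bir_morphism (A : atlas k) (b : A -> Bir) : Prop :=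
  exists (U V : set (prod_atlas A P2)) (f g : prod_atlas A P2 -> prod_atlas A P2),
  [/\ zopen U, zopen V, fst @` U = setT, fst @` V = setT
    & [/\ iso_on U V f g, (forall z, U z -> (f z).1 = z.1)
        & forall a, bir_class_of (b a) [set w | U (a, w)]
                      (fun w => (f (a, w)).2)]].

Definition bir_closed (F : set Bir) : Prop :=
  forall A : atlas k, is_variety A -> irreducible A ->
  forall b : A -> Bir, bir_morphism b -> zclosed (b @^-1` F).

Let bir_open (O : set Bir) : Prop := bir_closed (~` O).

Fact bir_openT : bir_open setT.
Proof. by move=> A _ _ b _; exact: (@zopenT k A). Qed.

Fact bir_openI : setI_closed bir_open.
Proof.
by move=> O1 O2 o1 o2 A vA iA b mb; exact: zopenI (o1 A vA iA b mb) (o2 A vA iA b mb).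
Qed.

Fact bir_open_bigU (I : Type) (O : I -> set Bir) :
  (forall i, bir_open (O i)) -> bir_open (\bigcup_i O i).
Proof.
move=> oO A vA iA b mb.
by apply: (@zopen_bigcup k A I setT (fun i => b @^-1` O i)) => i _; exact: oO mb.
Qed.

HB.instance Definition _ := isOpenTopological.Build Bir
  bir_openT bir_openI bir_open_bigU.

Lemma bir_closedE (F : set Bir) : closed F = bir_closed F.
Proof.
by rewrite -openC (_ : open (~` F) = bir_closed (~` ~` F)) // setCK.
Qed.

End BirationalMaps.

Section Groups.
Variable gT : groupType.
Implicit Types H : set gT.
Local Open Scope group_scope.

Definition is_subgroup H : Prop :=
  [/\ H 1, forall x y, H x -> H y -> H (x * y) & forall x, H x -> H x^-1].

Definition generated (A : set gT) : set gT :=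
  \bigcap_(H in [set H | is_subgroup H /\ A `<=` H]) H.

Definition derived_subgroup H : set gT :=
  generated [set z | exists x y, [/\ H x, H y & z = [~ x, y]]].

Definition is_solvable H : Prop :=
  exists n, iter n derived_subgroup H = [set 1].

Definition conj_subgroup (g : gT) H : set gT := [set g * h * g^-1 | h in H].

End Groups.

Section Jonquieres.
Variable k : closedFieldType.
Local Notation P2 := (projspace k 2).
Local Notation Bir := (Bir k).

Definition closed_connected_solvable (G : set Bir) : Prop :=
  [/\ is_subgroup G, closed G, connected G & is_solvable G].

Definition is_borel (G B : set Bir) : Prop :=
  [/\ closed_connected_solvable B, B `<=` G
    & forall B', closed_connected_solvable B' -> B' `<=` G -> B `<=` B' ->
        B' = B].

Definition affine_vec (z : k * k) : 'rV[k]_3 := \row_(i < 3) [:: z.1; z.2; 1]`_i.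

Lemma affine_vec_neq0 z : affine_vec z != 0.
Proof.
by apply/eqP => /rowP/(_ ord_max); rewrite !mxE /= => /eqP; rewrite oner_eq0.
Qed.

(** [(x, y)] is identified with [[x : y : 1]]. *)
Definition affine_point (z : k * k) : P2 := hline (affine_vec_neq0 z).

(** [b] is the birational map [z -> F z] of the affine plane. *)
Definition bir_affine (b : Bir) (F : k * k -> k * k) : Prop :=
  exists W : set P2, [/\ zopen W, W !=set0, W `<=` bdom (repr b)
    & forall z, W (affine_point z) ->
        repr b (affine_point z) = affine_point (F z)].

(** The value depends on the chosen fraction, and is meaningless at a zero of
    its denominator, but only at finitely many points [y]. *)
Definition frac_eval (r : {fraction {poly k}}) (y : k) : k :=
  (\n_(repr r)).[y] / (\d_(repr r)).[y].

Definition moebius (M : 'M[k]_2) (x : k) : k :=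
  (M 0 0 * x + M 0 1) / (M 1 0 * x + M 1 1).

Definition moebius_frac (M : 'M[{fraction {poly k}}]_2) (y x : k) : k :=
  moebius (map_mx (frac_eval^~ y) M) x.

Definition Jonq : set Bir := [set b | exists M N,
  [/\ M \in unitmx, N \in unitmx
    & bir_affine b (fun z => (moebius_frac M z.2 z.1, moebius N z.2))]].

(** The subgroup [PGL_2(k(y)) ><| Aff_1] of [Jonq]. *)
Definition Jonq_Aff : set Bir := [set b | exists M (a c : k),
  [/\ M \in unitmx, a != 0
    & bir_affine b (fun z => (moebius_frac M z.2 z.1, a * z.2 + c))]].

(** The subgroup [{1} ><| PGL_2] of [Jonq]. *)
Definition Jonq_PGL2 : set Bir := [set b | exists2 N, N \in unitmx
  & bir_affine b (fun z => (z.1, moebius N z.2))].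

End Jonquieres.

Arguments Jonq k : clear implicits.
Arguments Jonq_Aff k : clear implicits.
Arguments Jonq_PGL2 k : clear implicits.

(* Main.v *)
Require Import Defs.
From mathcomp Require Import all_boot all_order all_algebra.
From mathcomp Require Import classical_sets reals topology complex.
From mathcomp Require Import boolp mpoly ring.

Local Open Scope classical_set_scope.
Local Open Scope ring_scope.

(** A subgroup [G] of [Jonq] acts on [P^1] through the second coordinate. For
    points [p], [q] of [P^1], the elements of [G] acting by a homography that
    sends [p] to [q] are cut out in [G] by a closed subset of [Bir(P^2)]: a
    homography sends [p] to [q] iff the cross ratios of [(u1, u2, u3, p)] and of
    [(v1, v2, v3, q)] agree, where [vi] is the image of [ui], and this is a
    polynomial identity in the values of the birational map at three points.
    Hence, if [G] is connected, every point of [P^1] with a finite [G]-orbit is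
    fixed by [G]. If [G] is also solvable, let [A] be the last term of its
    derived series with a nontrivial image in [PGL_2]; this image is abelian, so
    commuting lifts to matrices commute up to sign. Take [a] in [A] acting
    nontrivially, with a fixed point [v]. If all of [A] fixes [v], the orbit of
    [v] consists of fixed points of [a]. Otherwise some [b] in [A] moves [v], and
    any element of [A] commutes as a matrix with [a], [b] or [a b], so the orbit
    of [v] consists of fixed points of [a], [b] or [a b]. Either way this orbit
    is finite, so [v] is fixed by [G], and it is moved to infinity by an element
    of [PGL_2]. The statement on Borel subgroups follows since conjugation is a
    homeomorphism of [Bir(P^2)] and conjugation by [PGL_2] preserves [Jonq]. *)

Set Implicit Arguments.
Unset Strict Implicit.
Unset Printing Implicit Defensive.

Import GRing.Theory.

(** * Groups and the projective line *)

Section GroupTheory.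
Variable gT : groupType.
Implicit Types (g h x : gT) (A H K : set gT).
Local Open Scope group_scope.

Lemma generated_subgroup A : is_subgroup (generated A).
Proof.
split=> [H [[]//]|x y Ax Ay H HA|x Ax H HA]; have [[_ HM HV] _] := HA.
- by apply: HM; [exact: Ax|exact: Ay].
- by apply: HV; exact: Ax.
Qed.

Lemma sub_generated A : A `<=` generated A.
Proof. by move=> x Ax H [_]; exact. Qed.

Lemma generated_min A H : is_subgroup H -> A `<=` H -> generated A `<=` H.
Proof. by move=> sH AH x; exact. Qed.

Lemma derived_sub H : is_subgroup H -> derived_subgroup H `<=` H.
Proof.
move=> sH; apply: generated_min => // _ [x [y [Hx Hy ->]]].
have [_ HM HV] := sH; apply: (HM _ _ (HV _ Hx)).
by apply: (HM _ _ (HV _ Hy)); exact: HM.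
Qed.

Lemma iter_derived_subgroup n H :
  is_subgroup H -> is_subgroup (iter n (@derived_subgroup gT) H).
Proof. by move=> sH; case: n => [//|n] /=; exact: generated_subgroup. Qed.

Lemma iter_derived_sub n H :
  is_subgroup H -> iter n (@derived_subgroup gT) H `<=` H.
Proof.
move=> sH; elim: n => //= n IH.
apply: subset_trans IH; apply: derived_sub; exact: iter_derived_subgroup.
Qed.

Lemma conj_subgroupE g H x : conj_subgroup g H x <-> H (x ^ g).
Proof.
split=> [[h Hh <-]|Hx]; first by rewrite conjgE !mulgA mulVg mul1g mulgVK.
by exists (x ^ g) => //; rewrite conjgE !mulgA mulgV mul1g mulgK.
Qed.

Lemma conj_subgroupK g H : conj_subgroup g (conj_subgroup g^-1 H) = H.
Proof.
by apply/seteqP; split=> x; rewrite !conj_subgroupE conjgK.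
Qed.

Lemma conj_subgroupVK g H : conj_subgroup g^-1 (conj_subgroup g H) = H.
Proof. by rewrite -{2}[H](conj_subgroupK g^-1) invgK. Qed.

Lemma conj_subgroup_sub g H K :
  H `<=` K -> conj_subgroup g H `<=` conj_subgroup g K.
Proof. by move=> HK x /conj_subgroupE/HK/conj_subgroupE. Qed.

Lemma conj_is_subgroup g H : is_subgroup H -> is_subgroup (conj_subgroup g H).
Proof.
move=> [H1 HM HV]; split=> [|x y|x]; rewrite !conj_subgroupE ?conj1g //.
  by rewrite conjMg; exact: HM.
by rewrite conjVg; exact: HV.
Qed.

Lemma conj_subgroup_id g H : is_subgroup H -> H g -> conj_subgroup g H = H.
Proof.
move=> [_ HM HV] Hg; apply/seteqP; split=> x.
  by move=> [h Hh <-]; apply: (HM); [exact: HM|exact: HV].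
by rewrite conj_subgroupE conjgE => Hx; apply: (HM); [exact: HV|exact: HM].
Qed.

(** One inclusion is proved for every [h] and [K]; the reverse one is this inclusion for [g^-1],
    conjugated back by [g]. *)
Lemma conj_derived g H :
  conj_subgroup g (derived_subgroup H) = derived_subgroup (conj_subgroup g H).
Proof.
have sub h K : derived_subgroup (conj_subgroup h K) `<=`
    conj_subgroup h (derived_subgroup K).
  apply: generated_min; first exact/conj_is_subgroup/generated_subgroup.
  move=> _ [x [y [/conj_subgroupE Kx /conj_subgroupE Ky ->]]].
  apply/conj_subgroupE; rewrite conjRg; apply: sub_generated.
  by exists (x ^ h), (y ^ h).
apply/seteqP; split; last exact: sub.
rewrite -[X in _ `<=` X](conj_subgroupK g).
apply: conj_subgroup_sub; rewrite -{1}[H](conj_subgroupVK g); exact: sub.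
Qed.

Lemma conj_iter_derived g n H :
  conj_subgroup g (iter n (@derived_subgroup gT) H) =
  iter n (@derived_subgroup gT) (conj_subgroup g H).
Proof. by elim: n => //= n <-; rewrite conj_derived. Qed.

Lemma conj_is_solvable g H : is_solvable H -> is_solvable (conj_subgroup g H).
Proof.
move=> [n Hn]; exists n; rewrite -conj_iter_derived Hn.
apply/seteqP; split=> x.
  by move=> /conj_subgroupE /= /eqP; rewrite conjg_eq1 => /eqP ->.
by move=> ->; apply/conj_subgroupE; rewrite conj1g.
Qed.

End GroupTheory.

(** * Brackets, eigenlines and commuting 2 by 2 matrices *)

Definition col2 (R : nzRingType) (x y : R) : 'cV[R]_2 := \col_i [:: x; y]`_i.

(** The determinant with columns [u] and [v]. For nonzero vectors over a field it vanishes iff they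
    span the same line, so [bracket (N *m p) q = 0] says that an invertible [N] sends the point [p]
    of the projective line to [q]. *)
Definition bracket (R : nzRingType) (u v : 'cV[R]_2) : R :=
  u 0 0 * v 1 0 - u 1 0 * v 0 0.

Lemma col2_1l_neq0 (R : nzRingType) (x : R) : col2 1 x != 0.
Proof. by apply/eqP => /colP/(_ 0); rewrite !mxE => /eqP; rewrite oner_eq0. Qed.

Lemma col2_1r_neq0 (R : nzRingType) (x : R) : col2 x 1 != 0.
Proof. by apply/eqP => /colP/(_ 1); rewrite !mxE => /eqP; rewrite oner_eq0. Qed.

Section PlaneLinearAlgebra.
Variable k : closedFieldType.
Implicit Types (u v w : 'cV[k]_2) (a b c d : 'M[k]_2).

Lemma ord2E (P : 'I_2 -> Prop) : P 0 -> P 1 -> forall i, P i.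
Proof.
move=> P0 P1 [[|[|//]] lt].
- by rewrite (_ : Ordinal lt = 0) //; exact/val_inj.
- by rewrite (_ : Ordinal lt = 1) //; exact/val_inj.
Qed.

Lemma mulmx2E a v i : (a *m v) i 0 = a i 0 * v 0 0 + a i 1 * v 1 0.
Proof.
rewrite mxE big_ord_recl big_ord1; by congr (_ + a i _ * v _ 0); exact/val_inj.
Qed.

Lemma mulmx22E a b i j : (a *m b) i j = a i 0 * b 0 j + a i 1 * b 1 j.
Proof.
rewrite mxE big_ord_recl big_ord1; by congr (_ + a i _ * b _ j); exact/val_inj.
Qed.

Lemma bracketC u v : bracket v u = - bracket u v.
Proof. rewrite /bracket; ring. Qed.

Lemma bracketZl t u v : bracket (t *: u) v = t * bracket u v.
Proof. rewrite /bracket !mxE; ring. Qed.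

Lemma bracketZr t u v : bracket u (t *: v) = t * bracket u v.
Proof. rewrite /bracket !mxE; ring. Qed.

Lemma bracketuu u : bracket u u = 0.
Proof. rewrite /bracket; ring. Qed.

Lemma col2_neq0 u : u != 0 -> u 0 0 != 0 \/ u 1 0 != 0.
Proof.
move=> u0; case: (eqVneq (u 0 0) 0) => [e0|]; last by left.
right; apply: contraNneq u0 => e1; apply/eqP/colP; apply: ord2E;
  by rewrite mxE.
Qed.

Lemma bracket_eq0 u v : u != 0 -> bracket u v = 0 -> exists t, v = t *: u.
Proof.
rewrite /bracket => /col2_neq0[] u0 /eqP; rewrite subr_eq0 => /eqP e.
  exists (v 0 0 / u 0 0); apply/colP; apply: ord2E; rewrite mxE.
    by rewrite divfK.
  by apply: (mulfI u0); rewrite e mulrA mulrCA divff ?mulr1 // mulrC.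
exists (v 1 0 / u 1 0); apply/colP; apply: ord2E; rewrite mxE.
  by apply: (mulfI u0); rewrite -e mulrA mulrCA divff ?mulr1 // mulrC.
by rewrite divfK.
Qed.

Lemma det2 (R : comNzRingType) (a : 'M[R]_2) : \det a = a 0 0 * a 1 1 - a 0 1 * a 1 0.
Proof.
rewrite (expand_det_row _ 0) big_ord_recl big_ord1 /cofactor !det_mx11 !mxE.
have -> : lift (0 : 'I_2) (0 : 'I_1) = 1 by exact/val_inj.
have -> : lift (1 : 'I_2) (0 : 'I_1) = 0 by exact/val_inj.
by rewrite addn0 expr0 expr1; ring.
Qed.

Lemma bracketM a u v : bracket (a *m u) (a *m v) = \det a * bracket u v.
Proof. rewrite /bracket !mulmx2E det2; ring. Qed.

Lemma scalar2P a : is_scalar_mx a <->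
  [/\ a 0 1 = 0, a 1 0 = 0 & a 0 0 = a 1 1].
Proof.
split=> [/is_scalar_mxP[t ->]|[e01 e10 e]]; first by rewrite !mxE.
apply/is_scalar_mxP; exists (a 0 0); apply/matrixP; apply: ord2E;
  by apply: ord2E; rewrite mxE.
Qed.

(** The form [bracket (c *m u) u] is quadratic in [u] and nonzero because [c] is not scalar, so it
    has finitely many zeros on the projective line. *)
Lemma eigen_lines c : ~~ is_scalar_mx c -> exists us : seq 'cV[k]_2,
  (forall u, u \in us -> u != 0) /\
  (forall u, bracket (c *m u) u = 0 -> exists2 w, w \in us & bracket u w = 0).
Proof.
move=> nsc; pose p := - c 1 0 *: 'X^2 + (c 0 0 - c 1 1) *: 'X + (c 0 1)%:P.
have p0 : p != 0.
  apply: contraNneq nsc => p0; apply/scalar2P.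
  have coefp i : p`_i = 0 by rewrite p0 coef0.
  have := (coefp 0, coefp 1, coefp 2)%N.
  rewrite /p !coefE /= !(mulr0, mulr1, addr0, add0r) => -[[-> /subr0_eq ->]].
  by move/eqP; rewrite oppr_eq0 => /eqP.
have [rs pE] := closed_field_poly_normal p.
(* The polynomial [p] is the quadratic form at [(t, 1)]. The point at infinity is listed in every
   case, although it is an eigenline only when [c 1 0 = 0]. *)
exists (col2 1 0 :: [seq col2 t 1 | t <- rs]); split=> [u|u].
  by rewrite inE => /orP[/eqP->|/mapP[t _ ->]];
    [exact: col2_1l_neq0|exact: col2_1r_neq0].
rewrite /bracket !mulmx2E => e; have [u1|u1] := eqVneq (u 1 0) 0.
  by exists (col2 1 0); rewrite ?mem_head // !mxE /= u1; ring.
exists (col2 (u 0 0 / u 1 0) 1); last by rewrite !mxE /=; field.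
rewrite inE; apply/orP; right; apply: map_f.
have : root p (u 0 0 / u 1 0).
  rewrite /root /p !(hornerD, hornerZ, hornerXn, hornerX, hornerC); apply/eqP.
  apply: (mulIf (expf_neq0 2 u1)); rewrite mul0r -[RHS]e; by field.
by rewrite pE rootZ ?lead_coef_eq0 // root_prod_XsubC.
Qed.

Lemma eigen_exists c : exists2 v, v != 0 & bracket (c *m v) v = 0.
Proof.
have [c10|c10] := eqVneq (c 1 0) 0.
  exists (col2 1 0); first exact: col2_1l_neq0.
  by rewrite /bracket !mulmx2E !mxE /= c10; ring.
pose p := Poly [:: c 0 1; c 0 0 - c 1 1; - c 1 0].
have pE : p = [:: c 0 1; c 0 0 - c 1 1; - c 1 0] :> seq k.
  by rewrite (@PolyK _ 0) //= oppr_eq0.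
have /closed_rootP[t] : size p != 1%N by rewrite pE.
rewrite /root horner_Poly /= => /eqP e; exists (col2 t 1); first exact: col2_1r_neq0.
rewrite /bracket !mulmx2E !mxE /= -[RHS]e; ring.
Qed.

Lemma two_eigen_scalar c t u w : bracket u w != 0 ->
  c *m u = t *: u -> c *m w = t *: w -> is_scalar_mx c.
Proof.
move=> uw /colP cu /colP cw.
have := (cu 0, cu 1, (cw 0, cw 1)); rewrite !mulmx2E !mxE.
case=> -[u0 u1] [w0 w1]; apply/scalar2P.
(* Cramer's rule: each quantity to be killed, multiplied by [bracket u w], is a combination of the
   four eigenvector equations. *)
have z x : bracket u w * x = 0 -> x = 0.
  by move=> /eqP; rewrite mulf_eq0 (negPf uw) => /eqP.
rewrite /bracket in z; split; [apply: z|apply: z|apply: subr0_eq; apply: z].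
- transitivity (u 0 0 * (c 0 0 * w 0 0 + c 0 1 * w 1 0) -
    w 0 0 * (c 0 0 * u 0 0 + c 0 1 * u 1 0)); first by ring.
  by rewrite w0 u0; ring.
- transitivity (w 1 0 * (c 1 0 * u 0 0 + c 1 1 * u 1 0) -
    u 1 0 * (c 1 0 * w 0 0 + c 1 1 * w 1 0)); first by ring.
  by rewrite w1 u1; ring.
- transitivity (w 1 0 * (c 0 0 * u 0 0 + c 0 1 * u 1 0) -
    u 1 0 * (c 0 0 * w 0 0 + c 0 1 * w 1 0) -
    (u 0 0 * (c 1 0 * w 0 0 + c 1 1 * w 1 0) -
    w 0 0 * (c 1 0 * u 0 0 + c 1 1 * u 1 0))); first by ring.
  by rewrite w0 u0 w1 u1; ring.
Qed.

(** If [d] moved the line of [u], then [d *m u] would be a second, independent eigenvector of [c]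
    for the same eigenvalue, making [c] scalar. *)
Lemma commute_eigen c d u : ~~ is_scalar_mx c -> c *m d = d *m c ->
  u != 0 -> bracket (c *m u) u = 0 -> bracket (d *m u) u = 0.
Proof.
move=> nsc cd u0 cu; apply/eqP/negPn/negP => du.
have [t ct] : exists t, c *m u = t *: u.
  by apply: bracket_eq0 => //; rewrite bracketC cu oppr0.
case/negP: nsc; apply: (two_eigen_scalar du _ ct).
by rewrite mulmxA cd -mulmxA ct -scalemxAr.
Qed.

(** Taking determinants gives [t ^+ 2 = 1]. *)
Lemma commute_sign a b t : a \in unitmx -> b \in unitmx ->
  a *m b = t *: (b *m a) -> a *m b = b *m a \/ a *m b = - (b *m a).
Proof.
rewrite !unitmxE !unitfE => a0 b0 e; have := congr1 determinant e.
rewrite detZ !det_mulmx mulrC -{1}[_ * _]mul1r => /mulIf -/(_ _)/esym.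
rewrite mulf_neq0 // => /(_ isT)/eqP; rewrite sqrf_eq1 e => /orP[]/eqP->.
  by left; rewrite scale1r.
by right; rewrite scaleN1r.
Qed.

End PlaneLinearAlgebra.

(** * Solvable groups acting on the projective line by matrices defined up to a scalar *)

Section ProjectiveAction.
Variables (k : closedFieldType) (gT : groupType) (G : set gT).
Variable act : gT -> 'M[k]_2 -> Prop.
Hypothesis subG : is_subgroup G.
Hypothesis solG : is_solvable G.
Hypothesis act_unit : forall g N, act g N -> N \in unitmx.
Hypothesis act1 : act 1%g 1%:M.
Hypothesis act_uniq : forall g M N, act g M -> act g N -> exists t, M = t *: N.
Hypothesis actM :
  forall g h M N, act g M -> act h N -> act (g * h)%g (M *m N).
Hypothesis actV : forall g N, act g N -> act g^-1%g (invmx N).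
(** The form in which connectedness enters this algebraic argument; [us] lists finitely many points
    containing the orbit of [v]. *)
Hypothesis fixed_of_finite_orbit : forall (v : 'cV[k]_2) (us : seq 'cV[k]_2),
  v != 0 -> (forall u, u \in us -> u != 0) ->
  (forall g N, G g -> act g N -> exists2 u, u \in us & bracket (N *m v) u = 0) ->
  forall g N, G g -> act g N -> bracket (N *m v) v = 0.

(** Triviality of the image of [H] in [PGL_2]. *)
Let scalar_on (H : set gT) := forall h N, H h -> act h N -> is_scalar_mx N.

Lemma last_nonscalar_derived : ~ scalar_on G -> exists n,
  ~ scalar_on (iter n (@derived_subgroup gT) G) /\
  scalar_on (iter n.+1 (@derived_subgroup gT) G).
Proof.
move=> nG; have [n Gn] := solG.
have : scalar_on (iter n (@derived_subgroup gT) G).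
  rewrite Gn => h N -> hN; have [t ->] := act_uniq hN act1.
  by rewrite scalemx1 scalar_mx_is_scalar.
elim: n {Gn} => [//|n IH] sn.
by have [|] := pselect (scalar_on (iter n (@derived_subgroup gT) G));
  [exact: IH|exists n].
Qed.

(** The commutator of [x] and [y] acts by a scalar [t], so [a *m b = t *: (b *m a)], and
    [commute_sign] applies. *)
Lemma commute_mod_scalars (H : set gT) x y a b : scalar_on (derived_subgroup H) ->
  H x -> H y -> act x a -> act y b -> a *m b = b *m a \/ a *m b = - (b *m a).
Proof.
move=> sH Hx Hy xa yb; have [ua ub] := (act_unit xa, act_unit yb).
have : is_scalar_mx (invmx a *m (invmx b *m (a *m b))).
  apply: (sH [~ x, y]%g); first by apply: sub_generated; exists x, y.
  by do !apply: actM => //; exact: actV.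
case/is_scalar_mxP => t e; apply: (@commute_sign _ _ _ t) => //.
have <- : b *m (a *m (invmx a *m (invmx b *m (a *m b)))) = a *m b.
  by rewrite mulKVmx // mulKVmx.
by rewrite e mulmxA mul_mx_scalar.
Qed.

Lemma solvable_fixes_line : exists2 v : 'cV[k]_2, v != 0 &
  forall g N, G g -> act g N -> bracket (N *m v) v = 0.
Proof.
have [sG|/last_nonscalar_derived[n []]] := pselect (scalar_on G).
  exists (col2 1 0) => [|g N Gg gN]; first exact: col2_1l_neq0.
  have /is_scalar_mxP[t ->] := sG _ _ Gg gN.
  by rewrite mul_scalar_mx bracketZl bracketuu mulr0.
set A := iter n _ G => nA /= sA.
have AG : A `<=` G by exact: iter_derived_sub.
(* Terms of the derived series are normal in [G], since conjugation commutes with taking derived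
   subgroups. *)
have nrmA g h : G g -> A h -> A (h ^ g)%g.
  move=> Gg; rewrite -conj_subgroupE conj_iter_derived conj_subgroup_id //.
have [x [a [Ax xa nsa]]] : exists x a, [/\ A x, act x a & ~~ is_scalar_mx a].
  apply: contrapT => nex; apply: nA => h N Ah hN; apply/negPn/negP => nsN.
  by apply: nex; exists h, N.
have ua := act_unit xa.
have [v v0 av] := eigen_exists a; exists v => //.
have [[y [b [Ay yb bv]]]|Afix] :=
  pselect (exists y b, [/\ A y, act y b & bracket (b *m v) v != 0]); last first.
  have {}Afix y b : A y -> act y b -> bracket (b *m v) v = 0.
    by move=> Ay yb; apply/eqP/negPn/negP => bv; apply: Afix; exists y, b.
  have [us [us0 usP]] := eigen_lines nsa.
  apply: (fixed_of_finite_orbit v0 us0) => g N Gg gN; apply: usP.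
  have uN := act_unit gN; have := uN; rewrite unitmxE unitfE => dN.
  (* The conjugate of [a] by [N] comes from [A] and so fixes [v]; applying [N], which multiplies
     brackets by [\det N], shows that [a] fixes [N *m v]. *)
  have := Afix _ _ (nrmA _ _ Gg Ax) (actM (actV gN) (actM xa gN)).
  move=> /(congr1 ( *%R (\det N))); rewrite mulr0 -bracketM.
  by rewrite -!mulmxA mulKVmx.
have ub := act_unit yb.
have nsb : ~~ is_scalar_mx b.
  apply: contraNN bv => /is_scalar_mxP[t ->].
  by rewrite mul_scalar_mx bracketZl bracketuu mulr0.
(* If [a *m b] were scalar, then [b] would fix the line of [v] as [a] does, contrary to the choice
   of [b]. *)
have nsab : ~~ is_scalar_mx (a *m b).
  apply: contraNN bv => /is_scalar_mxP[t e].
  move: ua; rewrite unitmxE unitfE => da.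
  have [s se] : exists s, a *m v = s *: v.
    by apply: bracket_eq0 => //; rewrite bracketC av oppr0.
  apply/eqP/(mulfI da); rewrite -bracketM mulmxA e se mul_scalar_mx.
  by rewrite bracketZl bracketZr bracketuu !mulr0.
have [us1 [us10 us1P]] := eigen_lines nsa.
have [us2 [us20 us2P]] := eigen_lines nsb.
have [us3 [us30 us3P]] := eigen_lines nsab.
apply: (fixed_of_finite_orbit (us := us1 ++ us2 ++ us3) v0) => [u|g N Gg gN].
  by rewrite !mem_cat => /or3P[]; [exact: us10|exact: us20|exact: us30].
have [_ _ GV] := subG; have uN := act_unit gN.
(* Transporting [a] by [N] gives a nonscalar [c], again coming from [A], that has [N *m v] as an
   eigenvector. *)
have [c [z [Az zc cE]]] : exists c z, [/\ A z, act z c & c *m N = N *m a].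
  exists (N *m (a *m invmx N)), (x ^ g^-1)%g; split.
  - by apply: nrmA => //; exact: GV.
  - by rewrite conjgE invgK; do !apply: actM => //; exact: actV.
  - by rewrite -!mulmxA mulVmx // mulmx1.
have nsc : ~~ is_scalar_mx c.
  apply: contraNN nsa => /is_scalar_mxP[t e]; apply/is_scalar_mxP; exists t.
  by rewrite -[LHS](mulKmx uN) -cE e mul_scalar_mx -scalemxAr mulVmx // scalemx1.
have Nv0 : N *m v != 0.
  by apply: contraNneq v0 => e; rewrite -[v](mulKmx uN) e mulmx0.
have cNv : bracket (c *m (N *m v)) (N *m v) = 0.
  by rewrite mulmxA cE -mulmxA bracketM av mulr0.
suff : [\/ bracket (a *m (N *m v)) (N *m v) = 0,
    bracket (b *m (N *m v)) (N *m v) = 0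
  | bracket (a *m b *m (N *m v)) (N *m v) = 0].
  case=> [/us1P|/us2P|/us3P] [w wus e]; exists w => //;
  by rewrite !mem_cat wus ?orbT.
have [ca|ca] := commute_mod_scalars sA Az Ax zc xa.
  by apply: Or31; exact: (commute_eigen nsc).
have [cb|cb] := commute_mod_scalars sA Az Ay zc yb.
  by apply: Or32; exact: (commute_eigen nsc).
(* Anticommuting with both [a] and [b], the matrix [c] commutes with their product. *)
apply: Or33; apply: (commute_eigen nsc) => //.
by rewrite -[RHS]mulmxA mulmxA ca mulNmx -mulmxA cb mulmxN opprK.
Qed.

End ProjectiveAction.

(** * Regular maps and the topology of [Bir] *)

Section RegularMaps.
Variable k : closedFieldType.
Implicit Types X Y Z : atlas k.

(** Regularity of a map to [P^n] in homogeneous coordinates: locally these are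
    polynomials, up to a nonzero factor that may vary with the point. *)
Definition hcoord_regular X n (U : set X) (f : X -> projspace k n) : Prop :=
  forall x i, U x -> chart_dom i x ->
  exists (q : {mpoly k[chart_dim i]}) (h : 'I_n.+1 -> {mpoly k[chart_dim i]}),
    q.@[chart i x 0] != 0 /\
    forall x', U x' -> chart_dom i x' -> q.@[chart i x' 0] != 0 ->
      exists2 t, t != 0 & forall m, hcoord (f x') 0 m = t * (h m).@[chart i x' 0].

Lemma regular_hcoord X n (U : set X) (f : X -> projspace k n) :
  regular_on U f <-> hcoord_regular U f.
Proof.
split=> [rf x i Ux ix|rf x i j Ux ix jx].
  have [j jx] := projspace_covered (f x).
  have [q [p [qx H]]] := rf x i j Ux ix jx.
  exists q, (fun m => if unlift j m is Some l then p l else q).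
  split=> // x' Ux' ix' qx'; have [jx' pE] := H _ Ux' ix' qx'.
  rewrite /= in jx' pE; exists (hcoord (f x') 0 j / q.@[chart i x' 0]).
    by rewrite mulf_neq0 ?invr_neq0.
  move=> m; case: unliftP => [l|] ->; last by rewrite divfK.
  by rewrite -mulrA [_^-1 * _]mulrC -pE mxE mulrCA divff ?mulr1.
have [q [h [qx H]]] := rf x i Ux ix.
exists (q * h j), (fun l => q * h (lift j l)); split=> [|x' Ux' ix'].
  have [t t0 hE] := H _ Ux ix qx; move: jx; rewrite /= hE mulf_eq0 (negPf t0) /=.
  by rewrite mevalM; exact: mulf_neq0.
rewrite mevalM mulf_eq0 negb_or => /andP[qx' hx'].
have [t t0 hE] := H _ Ux' ix' qx'; split=> [|l]; first by rewrite /= hE mulf_neq0.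
by rewrite mxE !hE mevalM -!mulf_div !divff ?mul1r.
Qed.

Lemma regular_pair X Y Z (U : set X) (f : X -> Y) (g : X -> Z) :
  regular_on U f -> regular_on U g ->
  regular_on (Y := prod_atlas Y Z) U (fun x => (f x, g x)).
Proof.
move=> rf rg x i [j1 j2] Ux ix [/= j1x j2x].
have [q1 [p1 [q1x H1]]] := rf _ _ _ Ux ix j1x.
have [q2 [p2 [q2x H2]]] := rg _ _ _ Ux ix j2x.
exists (q1 * q2), (fun l => match split l with
  inl l1 => p1 l1 * q2 | inr l2 => q1 * p2 l2 end).
split=> [|x' Ux' ix']; rewrite mevalM; first exact: mulf_neq0.
rewrite mulf_eq0 negb_or => /andP[q1x' q2x'].
have [j1x' E1] := H1 _ Ux' ix' q1x'; have [j2x' E2] := H2 _ Ux' ix' q2x'.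
split=> // l; rewrite mxE; case: (split l) => l'.
  by rewrite E1 mevalM -mulf_div divff ?mulr1.
by rewrite E2 mevalM -mulf_div divff ?mul1r.
Qed.

Lemma regular_cst X Y (U : set X) (y : Y) : regular_on U (fun=> y).
Proof.
move=> x i j _ _ jy; exists 1, (fun l => (chart j y 0 l)%:MP).
split=> [|x' _ _ _]; first by rewrite meval1 oner_neq0.
by split=> // l; rewrite mevalC meval1 divr1.
Qed.

(** The charts used at the source and at the target may differ, so the projection involves a change
    of charts of [X]; its polynomials are rewritten in the coordinates of the product. *)
Lemma regular_fst X Y : regular_on [set: X] id ->
  regular_on (X := prod_atlas X Y) setT fst.
Proof.
move=> rX [x y] [i m] j _ [/= ix my] jx.
have [q [p [qx H]]] := rX x i j I ix jx.
pose s := [tuple ('X_(lshift (chart_dim m) l) : {mpoly k[_]}) | l < chart_dim i].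
have sE (r : {mpoly k[chart_dim i]}) x' y' :
    (r \mPo s).@[row_mx (chart i x') (chart m y') 0] = r.@[chart i x' 0].
  rewrite comp_mpoly_meval; apply: meval_eq => l.
  by rewrite tnth_mktuple mevalXU row_mxEl.
exists (q \mPo s), (fun l => p l \mPo s); rewrite sE; split=> //.
move=> [x' y'] _ [/= ix' my']; rewrite sE => qx'.
have [jx' E] := H _ I ix' qx'; split=> // l; by rewrite sE E.
Qed.

Lemma regular_snd X Y : regular_on [set: Y] id ->
  regular_on (X := prod_atlas X Y) setT snd.
Proof.
move=> rY [x y] [m i] j _ [/= mx iy] jy.
have [q [p [qy H]]] := rY y i j I iy jy.
pose s := [tuple ('X_(rshift (chart_dim m) l) : {mpoly k[_]}) | l < chart_dim i].
have sE (r : {mpoly k[chart_dim i]}) x' y' :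
    (r \mPo s).@[row_mx (chart m x') (chart i y') 0] = r.@[chart i y' 0].
  rewrite comp_mpoly_meval; apply: meval_eq => l.
  by rewrite tnth_mktuple mevalXU row_mxEr.
exists (q \mPo s), (fun l => p l \mPo s); rewrite sE; split=> //.
move=> [x' y'] _ [/= mx' iy']; rewrite sE => qy'.
have [jy' E] := H _ I iy' qy'; split=> // l; by rewrite sE E.
Qed.

Lemma prod_covered X Y : covered X -> covered Y -> covered (prod_atlas X Y).
Proof.
by move=> cX cY [x y]; have [i ix] := cX x; have [j jy] := cY y; exists (i, j).
Qed.

Lemma variety_covered X : is_variety X -> covered X.
Proof.
move=> [E _ _ _ _] x; have : setT x by [].
by rewrite -E => -[i _ ix]; exists i.
Qed.

(** Polynomiality is expressed by substitution: feeding [T] with polynomials yields a polynomial.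
    This avoids naming a polynomial ring on the entries of a family of vectors. *)
Definition polynomial_map (I : finType) n (T : (I -> 'rV[k]_n) -> k) : Prop :=
  forall m (h : I -> 'I_n -> {mpoly k[m]}),
  exists d : {mpoly k[m]}, forall v, T (fun i => \row_l (h i l).@[v]) = d.@[v].

(** The representative [hcoord] is chosen arbitrarily, so it is polynomial only up to a nonzero
    factor varying with the point. The last hypothesis, a weak multihomogeneity, makes the vanishing
    of [T] insensitive to these factors. *)
Lemma zopen_neq0 X (I : finType) n (U : set X) (f : I -> X -> projspace k n)
    (T : (I -> 'rV[k]_n.+1) -> k) :
  zopen U -> (forall i, regular_on U (f i)) -> polynomial_map T ->
  (forall (s : I -> k) v, (forall i, s i != 0) ->
    (T (fun i => s i *: v i) == 0) = (T v == 0)) ->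
  zopen [set x | U x /\ T (fun i => hcoord (f i x)) != 0].
Proof.
move=> /zopenP oU rf pT hT; apply/zopenP => x i [Ux Tx] ix.
have [r rx Hr] := oU _ _ Ux ix.
have /choice[q /choice[h H]] i' := (regular_hcoord U (f i')).1 (rf i') x i Ux ix.
have [d dE] := pT _ h.
have TE x' : U x' -> chart_dom i x' -> (forall j, (q j).@[chart i x' 0] != 0) ->
    (T (fun j => hcoord (f j x')) != 0) = (d.@[chart i x' 0] != 0).
  move=> Ux' ix' qx'.
  have /choice[t tE] j : exists t, t != 0 /\
      forall m, hcoord (f j x') 0 m = t * (h j m).@[chart i x' 0].
    by have [_ /(_ _ Ux' ix' (qx' j))[t t0 tE]] := H j; exists t.
  have -> : (fun j => hcoord (f j x')) =
      (fun j => t j *: \row_l (h j l).@[chart i x' 0]).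
    by apply/funext => j; apply/rowP => m; rewrite !mxE; have [_ ->] := tE j.
  rewrite hT => [|j]; last by have [] := tE j.
  by rewrite dE.
have qE x' : (r * d * \prod_j q j).@[chart i x' 0] =
    r.@[chart i x' 0] * d.@[chart i x' 0] * \prod_j (q j).@[chart i x' 0].
  by rewrite !mevalM rmorph_prod.
exists (r * d * \prod_j q j).
  rewrite qE !mulf_neq0 // -?TE // => [j|]; first by have [] := H j.
  by apply/prodf_neq0 => j _; have [] := H j.
move=> x' ix'; rewrite qE !mulf_eq0 !negb_or => /andP[/andP[rx' dx']].
move=> /prodf_neq0 qx'; have Ux' := Hr _ ix' rx'; split=> //.
by rewrite TE // => j; exact: qx'.
Qed.

Lemma zopen_preimageT X Y (O : set Y) (f : X -> Y) :
  covered Y -> regular_on setT f -> zopen O -> zopen (f @^-1` O).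
Proof.
move=> cY rf oO; rewrite -[_ @^-1` _]setTI; apply: zopen_preimage => //.
exact: zopenT.
Qed.

End RegularMaps.

(** * Fibres of families of birational maps, and continuity of the group operations *)

Section Morphisms.
Variable k : closedFieldType.
Local Notation P2 := (projspace k 2).
Local Notation Bir := (Bir k).

Let cP : covered P2 := @projspace_covered k 2.

Lemma bir_eq_repr (b : Bir) r : b = (\pi_Bir r)%qT <-> bir_agree (repr b) r.
Proof. by rewrite -bir_eqP reprK. Qed.

Section Slices.
Variables (A : atlas k) (U V : set (prod_atlas A P2)).
Variables f g : prod_atlas A P2 -> prod_atlas A P2.
Hypotheses (vA : is_variety A) (oU : zopen U) (oV : zopen V).
Hypotheses (sU : fst @` U = setT) (isofg : iso_on U V f g).
Hypothesis f1 : forall z, U z -> (f z).1 = z.1.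

Let cA : covered A := variety_covered vA.
Let cAP : covered (prod_atlas A P2) := prod_covered cA cP.

Lemma regular_pairl (a : A) :
  regular_on (Y := prod_atlas A P2) [set: P2] (fun w => (a, w)).
Proof. by apply: regular_pair; [exact: regular_cst|exact: regular_projspace_id]. Qed.

Lemma regular_pairr (w : P2) :
  regular_on (Y := prod_atlas A P2) [set: A] (fun a => (a, w)).
Proof. by case: vA => _ _ _ rA _; apply: regular_pair => //; exact: regular_cst. Qed.

Lemma regular_P2_snd : regular_on (X := prod_atlas A P2) setT snd.
Proof. exact/regular_snd/regular_projspace_id. Qed.

Lemma zopen_slice (a : A) (W : set (prod_atlas A P2)) :
  zopen W -> zopen [set w : P2 | W (a, w)].
Proof. by apply: zopen_preimageT => //; exact: regular_pairl. Qed.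

Lemma zopen_sliceP (w : P2) (W : set (prod_atlas A P2)) :
  zopen W -> zopen [set a : A | W (a, w)].
Proof. by apply: zopen_preimageT => //; exact: regular_pairr. Qed.

Lemma regular_slice (a : A) (W : set (prod_atlas A P2))
    (h : prod_atlas A P2 -> prod_atlas A P2) : regular_on W h ->
  regular_on [set w | W (a, w)] (fun w => (h (a, w)).2).
Proof.
move=> rh; apply: (@regular_comp _ _ _ P2 _ setT (fun w => h (a, w)) snd cAP) => //.
  apply: (@regular_comp _ _ _ _ _ W (fun w => (a, w)) h cAP) => //.
  exact: (regular_sub (subsetT _) (@regular_pairl a)).
exact: regular_P2_snd.
Qed.

Lemma regular_sliceP (w : P2) (W : set (prod_atlas A P2))
    (h : prod_atlas A P2 -> prod_atlas A P2) : regular_on W h ->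
  regular_on [set a | W (a, w)] (fun a => (h (a, w)).2).
Proof.
move=> rh; apply: (@regular_comp _ _ _ P2 _ setT (fun a => h (a, w)) snd cAP) => //.
  apply: (@regular_comp _ _ _ _ _ W (fun a => (a, w)) h cAP) => //.
  exact: (regular_sub (subsetT _) (@regular_pairr w)).
exact: regular_P2_snd.
Qed.

Lemma slice_iso a : iso_on [set w | U (a, w)] [set w | V (a, w)]
  (fun w => (f (a, w)).2) (fun w => (g (a, w)).2).
Proof.
have [fK gK rf rg] := isofg.
split=> [w Uw|w Vw||]; [| |exact: regular_slice|exact: regular_slice].
- have /= := f1 Uw; have := fK _ Uw.
  by case: (f (a, w)) => a' w' /= + ea; rewrite {}ea => -[? ->].
- have [Ug e] := gK _ Vw; have := f1 Ug; rewrite e /=.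
  by case: (g (a, w)) Ug e => a' w' /= + + ea; rewrite -{}ea => ? ->.
Qed.

Lemma slice_neq0 (a : A) : [set w : P2 | U (a, w)] !=set0.
Proof.
have : [set: A] a by []; rewrite -sU => -[[a' w] Uw /= <-]; by exists w.
Qed.

(** The restriction of the family to the fibre over [a]: an explicit presentation of the member of
    the family at [a], which lets products and inverses be computed by [bir_mulE] and [bir_invE]. *)
Definition slice (a : A) : birep k :=
  Birep (@zopen_slice a _ oU) (@zopen_slice a _ oV)
    (@slice_neq0 a) (@slice_iso a).

Lemma bir_class_slice (b : Bir) a :
  bir_class_of b [set w | U (a, w)] (fun w => (f (a, w)).2) <->
  b = (\pi_Bir (slice a))%qT.
Proof. by rewrite bir_eq_repr. Qed.

End Slices.

Lemma bir_morphism_inv (A : atlas k) (b : A -> Bir) : is_variety A ->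
  bir_morphism b -> bir_morphism (fun a => (b a)^-1%g).
Proof.
move=> vA [U [V [f [g [oU oV sU sV [iso f1 bE]]]]]].
have [fK gK rf rg] := iso.
exists V, U, g, f; split=> //; split=> // [z Vz|a].
  by have [Ug e] := gK _ Vz; rewrite -(f1 _ Ug) e.
have /(bir_class_slice vA oU oV sU iso f1) -> := bE a.
by rewrite [(_)^-1%g]bir_invE; exact: bir_reprK.
Qed.

(** The family is composed fibrewise with a presentation [r] of [c], after shrinking [U] to the
    points whose image lies in the domain of [r]. *)
Lemma bir_morphism_mull (A : atlas k) (c : Bir) (b : A -> Bir) : is_variety A ->
  bir_morphism b -> bir_morphism (fun a => (c * b a)%g).
Proof.
move=> vA [U [V [f [g [oU oV sU sV [iso f1 bE]]]]]].
have [fK gK rf rg] := iso.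
pose r := repr c; have [_ _ rr ri] := birep_iso r.
have cA := variety_covered vA; have cAP := prod_covered cA cP.
have rA : regular_on [set: A] id by case: vA.
have r2 := @regular_P2_snd A.
have r1 : regular_on (X := prod_atlas A P2) setT fst by exact: regular_fst.
have g1 z : V z -> (g z).1 = z.1.
  by move=> Vz; have [Ug e] := gK _ Vz; rewrite -(f1 _ Ug) e.
pose U' : set (prod_atlas A P2) := [set z | U z /\ bdom r (f z).2].
pose C : set (prod_atlas A P2) := [set z | bcod r z.2].
pose j : prod_atlas A P2 -> prod_atlas A P2 := fun z => (z.1, binv r z.2).
pose f' : prod_atlas A P2 -> prod_atlas A P2 := fun z => (z.1, r (f z).2).
pose V' : set (prod_atlas A P2) := C `&` j @^-1` V.
have oC : zopen C by apply: zopen_preimageT => //; exact: bcod_open.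
have rj : regular_on C j.
  apply: regular_pair; first exact: regular_sub r1.
  by apply: (regular_comp (V := bcod r) cP (g := binv r)) => //;
    exact: regular_sub r2.
have rf2 : regular_on U (snd \o f) by exact: (regular_comp (V := setT) cAP).
have U'V' z : U' z -> V' (f' z) /\ g (j (f' z)) = z.
  move=> [Uz dz]; have [/= cz e] := bdomK dz; have [Vz gz] := fK _ Uz.
  rewrite /V' /j /f' /= e (_ : (z.1, (f z).2) = f z) //.
  by rewrite -(f1 _ Uz); case: (f z).
have V'U' z : V' z -> U' (g (j z)) /\ f' (g (j z)) = z.
  move=> [Cz Vz]; have [dz /= e] := bcodK Cz; have [Uz fz] := gK _ Vz.
  split; first by split=> //; rewrite fz.
  by rewrite /f' fz (g1 _ Vz) /= e; case: (z).
exists U', V', f', (g \o j); split.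
- rewrite (_ : U' = U `&` (snd \o f) @^-1` bdom r) //.
  by apply: zopen_preimage => //; exact: bdom_open.
- by apply: zopen_preimage.
(* No fibre is lost by shrinking: the image of each slice is a nonempty open set, hence meets the
   domain of [r]. *)
- apply/seteqP; split=> // a _.
  have [w [Uw dw]] := bcod_meet (slice vA oU oV sU iso f1 a) (bdom_open r) (bdom_neq0 r).
  by exists (a, w).
- apply/seteqP; split=> // a _.
  have [w [Uw dw]] := bcod_meet (slice vA oU oV sU iso f1 a) (bdom_open r) (bdom_neq0 r).
  exists (f' (a, w)) => //; exact: (U'V' (a, w) (conj Uw dw)).1.
split=> // [|a].
  split=> //.
  - apply: regular_pair; first exact: regular_sub r1.
    apply: (regular_comp (V := bdom r) cP (g := r)) => //; first by move=> z [].
    by apply: regular_sub rf2 => z [].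
  - apply: (regular_comp (V := V) cAP) => //; first by move=> z [].
    by apply: regular_sub rj => z [].
have /(bir_class_slice vA oU oV sU iso f1) -> := bE a.
have -> : (c * (\pi_Bir (slice vA oU oV sU iso f1 a))%qT)%g =
    (\pi_Bir (birep_comp r (slice vA oU oV sU iso f1 a)))%qT.
  by rewrite -bir_mulE reprK.
exact: bir_reprK.
Qed.

Lemma bir_inv_continuous : continuous (fun b : Bir => b^-1%g).
Proof.
apply/continuous_closedP => F; rewrite !bir_closedE => cF A vA iA b mb.
exact: (cF _ vA iA _ (bir_morphism_inv vA mb)).
Qed.

Lemma bir_mull_continuous (c : Bir) : continuous (fun b : Bir => (c * b)%g).
Proof.
apply/continuous_closedP => F; rewrite !bir_closedE => cF A vA iA b mb.
exact: (cF _ vA iA _ (bir_morphism_mull c vA mb)).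
Qed.

Lemma bir_conj_continuous (c : Bir) : continuous (fun b : Bir => (c * b * c^-1)%g).
Proof.
(* Conjugation is built from inversion and left multiplication alone: it sends [b] to
   [c * (c * b^-1)^-1]. *)
rewrite (_ : (fun b => _) =
  ( *%g c) \o ((fun b : Bir => b^-1%g) \o (( *%g c) \o (fun b : Bir => b^-1%g)))).
  move=> b; apply: continuous_comp; last exact: bir_mull_continuous.
  apply: continuous_comp; last exact: bir_inv_continuous.
  by apply: continuous_comp; [exact: bir_inv_continuous|
    exact: bir_mull_continuous].
by apply/funext => b /=; rewrite invgM invgK mulgA.
Qed.

Lemma conj_closed_connected_solvable (c : Bir) G :
  closed_connected_solvable G -> closed_connected_solvable (conj_subgroup c G).
Proof.
move=> [sG clG coG soG]; split.
- exact: conj_is_subgroup.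
- rewrite (_ : conj_subgroup c G = (fun b => (c^-1 * b * c^-1^-1)%g) @^-1` G).
    exact: ((continuous_closedP _).1 (@bir_conj_continuous c^-1%g)).
  by apply/seteqP; split=> b; rewrite conj_subgroupE /= conjgE invgK mulgA.
- apply: connected_continuous_connected => //.
  exact/continuous_subspaceT/bir_conj_continuous.
- exact: conj_is_solvable.
Qed.

End Morphisms.

(** * The action on the second coordinate *)

(** Homogeneous form of [(x, y) |-> y], that is, the projection of the plane from [[1 : 0 : 0]],
    where it takes the meaningless value zero. *)
Definition ypart (R : nzRingType) (v : 'rV[R]_3) : 'cV[R]_2 :=
  col2 (v 0 1) (v 0 ord_max).

(** Vanishes iff the cross ratio of [u1, u2, u3, p] equals that of
    [v1, v2, v3, q] (as points of [P^1]); see [cross_acts]. *)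
Definition cross (R : nzRingType) (p q u1 v1 u2 v2 u3 v3 : 'cV[R]_2) : R :=
  bracket p u2 * bracket u1 u3 * (bracket v2 v3 * bracket v1 q) -
  bracket u1 p * bracket u3 u2 * (bracket v1 v3 * bracket v2 q).

Section CrossRatio.
Variable k : closedFieldType.
Implicit Types (p q u v w : 'cV[k]_2) (N : 'M[k]_2).

Lemma ypartZ t (v : 'rV[k]_3) : ypart (t *: v) = t *: ypart v.
Proof. by apply/colP; apply: ord2E; rewrite !mxE. Qed.

Lemma crossZ p q u1 v1 u2 v2 u3 v3 s1 t1 s2 t2 s3 t3 :
  cross p q (s1 *: u1) (t1 *: v1) (s2 *: u2) (t2 *: v2) (s3 *: u3) (t3 *: v3) =
  s1 * t1 * (s2 * t2) * (s3 * t3) * cross p q u1 v1 u2 v2 u3 v3.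
Proof. rewrite /cross !bracketZl !bracketZr; ring. Qed.

Lemma cross_acts p q N u1 u2 u3 :
  cross p q u1 (N *m u1) u2 (N *m u2) u3 (N *m u3) =
  \det N * bracket u1 u2 * bracket u1 u3 * bracket u2 u3 * bracket (N *m p) q.
Proof.
rewrite /cross !bracketM /bracket !mulmx2E; ring.
Qed.

Lemma cross_meval n (P Q U1 V1 U2 V2 U3 V3 : 'cV[{mpoly k[n]}]_2)
    (v : 'I_n -> k) :
  (cross P Q U1 V1 U2 V2 U3 V3).@[v] =
  cross (map_mx (meval v) P) (map_mx (meval v) Q)
    (map_mx (meval v) U1) (map_mx (meval v) V1)
    (map_mx (meval v) U2) (map_mx (meval v) V2)
    (map_mx (meval v) U3) (map_mx (meval v) V3).
Proof. by rewrite /cross /bracket !mxE !(mevalB, mevalM). Qed.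

Lemma map_meval_const n u (v : 'I_n -> k) :
  map_mx (meval v) (map_mx (@mpolyC n k) u) = u.
Proof. by apply/colP => i; rewrite !mxE mevalC. Qed.

Lemma map_meval_ypart n (h : 'I_3 -> {mpoly k[n]}) (v : 'I_n -> k) :
  map_mx (meval v) (ypart (\row_l h l)) = ypart (\row_l (h l).@[v]).
Proof. by apply/colP; apply: ord2E; rewrite !mxE. Qed.

End CrossRatio.

Section ActionOnLines.
Variable k : closedFieldType.
Local Notation P2 := (projspace k 2).
Local Notation Bir := (Bir k).
Local Notation yp w := (ypart (hcoord w)).

Let cP : covered P2 := @projspace_covered k 2.

Lemma zopen_locally (X : atlas k) (W : set X) :
  (forall x, W x -> exists O, [/\ zopen O, O x & O `<=` W]) -> zopen W.
Proof.
move=> H; apply/zopenP => x i Wx ix; have [O [/zopenP oO Ox OW]] := H _ Wx.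
by have [q qx Hq] := oO _ _ Ox ix; exists q => // x' ix' /Hq-/(_ ix')/OW.
Qed.

Lemma zopen_ybracket (e : 'cV[k]_2) : zopen [set w : P2 | bracket e (yp w) != 0].
Proof.
have -> : [set w : P2 | bracket e (yp w) != 0] =
    [set w | setT w /\ bracket e (yp w) != 0].
  by apply/seteqP; split=> w // [].
apply: (zopen_neq0 (I := unit) (f := fun _ w => w)
  (T := fun v => bracket e (ypart (v tt)))).
- exact: zopenT.
- by move=> _; exact: regular_projspace_id.
- move=> m h; exists (bracket (map_mx (@mpolyC m k) e) (ypart (\row_l h tt l))) => v.
  by rewrite /bracket !mxE mevalB !mevalM !mevalC.
- move=> s v s0; by rewrite ypartZ bracketZr mulf_eq0 (negPf (s0 tt)).
Qed.

Lemma ybracket_neq0 (e : 'cV[k]_2) : e != 0 ->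
  [set w : P2 | bracket e (yp w) != 0] !=set0.
Proof.
move=> e0; pose r x y : 'rV[k]_3 := \row_(i < 3) [:: 0; x; y]`_i.
have rE x y (xy : r x y != 0) : bracket e (col2 x y) != 0 ->
    [set w : P2 | bracket e (yp w) != 0] !=set0.
  move=> exy; have [c c0 cE] := hcoord_hline xy; exists (hline xy) => /=.
  have -> : yp (hline xy) = c *: col2 x y.
    by rewrite cE ypartZ; congr (_ *: _); apply/colP; apply: ord2E; rewrite !mxE.
  by rewrite bracketZr mulf_neq0.
have [e00|e10] := col2_neq0 e0.
  apply: (rE 0 1); last by rewrite /bracket !mxE /= mulr1 mulr0 subr0.
  by apply/eqP => /rowP/(_ ord_max); rewrite !mxE /= => /eqP; rewrite oner_eq0.
apply: (rE 1 0); last by rewrite /bracket !mxE /= mulr1 mulr0 sub0r oppr_eq0.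
by apply/eqP => /rowP/(_ 1); rewrite !mxE /= => /eqP; rewrite oner_eq0.
Qed.

(** General position: each condition defines a nonempty open set, and nonempty open sets of the
    plane meet. *)
Lemma meet_ybrackets (W : set P2) (us : seq 'cV[k]_2) :
  zopen W -> W !=set0 -> (forall u, u \in us -> u != 0) ->
  exists2 w, W w & forall u, u \in us -> bracket u (yp w) != 0.
Proof.
move=> + + us0; elim: us us0 W => [|u us IH] us0 W oW W0.
  by have [w Ww] := W0; exists w.
have [|||w [Ww uw] usw] := IH _ (W `&` [set w | bracket u (yp w) != 0]).
- by move=> u' u'us; apply: us0; rewrite inE u'us orbT.
- by apply: zopenI => //; exact: zopen_ybracket.
- apply: projspace_meet => //; first exact: zopen_ybracket.
  by apply: ybracket_neq0; apply: us0; rewrite mem_head.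
by exists w => // u'; rewrite inE => /orP[/eqP->//|]; exact: usw.
Qed.

(** Near a general point, the second affine coordinate of [r] is the image of
    the second affine coordinate of its argument under the homography [N]. *)
Definition birep_acts (r : birep k) (N : 'M[k]_2) : Prop :=
  N \in unitmx /\ exists W : set P2, [/\ zopen W, W !=set0, W `<=` bdom r
    & forall w, W w -> yp w != 0 /\
        exists2 t, t != 0 & yp (r w) = t *: (N *m yp w)].

Definition bir_acts (b : Bir) (N : 'M[k]_2) : Prop := birep_acts (repr b) N.

Lemma birep_acts_agree r s N : bir_agree r s -> birep_acts r N -> birep_acts s N.
Proof.
move=> [V [oV V0 VD HV]] [uN [W [oW W0 WD HW]]]; split=> //.
exists (V `&` W); split; [exact: zopenI|exact: projspace_meet| |].
- by move=> w [/VD[]].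
- by move=> w [Vw Ww]; rewrite -HV //; exact: HW.
Qed.

Lemma bir_acts_pi r N : birep_acts r N -> bir_acts (\pi_Bir r)%qT N.
Proof. by apply: birep_acts_agree; apply: bir_agree_sym; exact: bir_reprK. Qed.

Lemma bir_acts_unit b N : bir_acts b N -> N \in unitmx.
Proof. by case. Qed.

Lemma bir_acts1 : bir_acts 1%g 1%:M.
Proof.
apply: (@bir_acts_pi (birep_id k)); split; first exact: unitmx1.
exists [set w | bracket (col2 1 0) (yp w) != 0].
split=> //; [exact: zopen_ybracket|exact/ybracket_neq0/col2_1l_neq0|move=> w we; split].
  by apply: contraNneq we => ->; rewrite /bracket !mxE !mulr0 subr0.
by exists 1; rewrite ?oner_neq0 // mul1mx scale1r.
Qed.

Lemma bir_actsM b c M N : bir_acts b M -> bir_acts c N ->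
  bir_acts (b * c)%g (M *m N).
Proof.
move=> [uM [W [oW W0 WD HW]]] [uN [V [oV V0 VD HV]]].
apply: (@bir_acts_pi (birep_comp (repr b) (repr c))).
split; first by rewrite unitmx_mul uM.
exists ((bdom (repr c) `&` repr c @^-1` W) `&` V); split.
- apply: zopenI => //; apply: zopen_preimage => //; first exact: bdom_open.
  by case: (birep_iso (repr c)).
- apply: projspace_meet => //; last exact: bcod_meet.
  apply: zopen_preimage => //; first exact: bdom_open.
  by case: (birep_iso (repr c)).
- by move=> w [[cw Wcw] _]; split=> //; exact: WD.
- move=> w [[cw Wcw] Vw]; have [yw0 [t t0 tE]] := HV _ Vw; split=> //=.
  have [_ [s s0 ->]] := HW _ Wcw; exists (s * t); first by rewrite mulf_neq0.
  by rewrite tE -scalemxAr scalerA mulmxA.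
Qed.

Lemma bir_actsV b N : bir_acts b N -> bir_acts b^-1%g (invmx N).
Proof.
move=> [uN [W [oW [w0 Ww0] WD HW]]].
apply: (@bir_acts_pi (birep_inv (repr b))); split; first by rewrite unitmx_inv.
exists (bcod (repr b) `&` binv (repr b) @^-1` W); split.
- apply: zopen_preimage => //; first exact: bcod_open.
  by case: (birep_iso (repr b)).
- by have [cw e] := bdomK (WD _ Ww0); exists (repr b w0); split=> //=; rewrite e.
- by move=> w [].
move=> w [/bcodK[dw e] Ww]; have [y0 [t t0]] := HW _ Ww; rewrite e => yE.
split=> /=; last first.
  exists t^-1; first by rewrite invr_neq0.
  by rewrite yE -scalemxAr scalerA mulVf // scale1r mulKmx.
rewrite yE scaler_eq0 negb_or t0; apply: contraNneq y0 => Ny.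
by rewrite -[yp _](mulKmx uN) Ny mulmx0.
Qed.

(** The matrix [invmx N *m M] fixes the second coordinate of every general point, whereas a
    nonscalar matrix has only finitely many eigenlines. *)
Lemma bir_acts_uniq b M N : bir_acts b M -> bir_acts b N -> exists t, M = t *: N.
Proof.
move=> [uM [W [oW W0 WD HW]]] [uN [V [oV V0 VD HV]]].
suff : is_scalar_mx (invmx N *m M).
  case/is_scalar_mxP => t e; exists t.
  by rewrite -[LHS](mulKVmx uN) e mul_mx_scalar.
apply/negPn/negP => /eigen_lines[us [us0 usP]].
have [w [Ww Vw] wus] := meet_ybrackets (zopenI oW oV)
  (projspace_meet oW oV W0 V0) us0.
have [_ [t t0 tE]] := HW _ Ww; have [_ [s s0 sE]] := HV _ Vw.
have [|u uus /eqP] := usP (yp w); last first.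
  by rewrite bracketC oppr_eq0; apply/negP; exact: wus.
rewrite -mulmxA -[M *m _](scalerK t0) -tE sE -!scalemxAr mulKmx //.
by rewrite !bracketZl bracketuu !mulr0.
Qed.

Section CrossDense.
Variables (U : set P2) (f : P2 -> P2).
Hypotheses (oU : zopen U) (rf : regular_on U f).

(** Identity principle: a nonempty nonvanishing locus would be open and meet [W]. The Boolean index
    distinguishes the point ([true]) from its image ([false]). *)
Lemma vanish_dense (T : (bool -> 'rV[k]_3) -> k) (W : set P2) :
  polynomial_map T ->
  (forall (s : bool -> k) v, (forall i, s i != 0) ->
    (T (fun i => s i *: v i) == 0) = (T v == 0)) ->
  zopen W -> W !=set0 ->
  (forall w, W w -> T (fun i => hcoord (if i then w else f w)) = 0) ->
  forall w, U w -> T (fun i => hcoord (if i then w else f w)) = 0.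
Proof.
move=> pT hT oW W0 WT w Uw; apply/eqP/negPn/negP => Tw.
have [||w' [[_ T0] /WT]] := projspace_meet
  (zopen_neq0 (f := fun (i : bool) w => if i then w else f w) oU _ pT hT) oW _ W0.
- by case=> //; apply: regular_sub (@regular_projspace_id k 2).
- by exists w.
by move/eqP: T0.
Qed.

(** The three points are released from [W] to [U] one at a time, the other two being held fixed. *)
Lemma cross_dense p q (W : set P2) : zopen W -> W !=set0 -> W `<=` U ->
  (forall w1 w2 w3, W w1 -> W w2 -> W w3 ->
    cross p q (yp w1) (yp (f w1)) (yp w2) (yp (f w2)) (yp w3) (yp (f w3)) = 0) ->
  forall w1 w2 w3, U w1 -> U w2 -> U w3 ->
    cross p q (yp w1) (yp (f w1)) (yp w2) (yp (f w2)) (yp w3) (yp (f w3)) = 0.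
Proof.
move=> oW W0 WU H.
have neq0 (s : bool -> k) : (forall i, s i != 0) -> s true * s false == 0 = false.
  by move=> s0; apply/negbTE; rewrite mulf_neq0.
have H1 w1 w2 w3 : U w1 -> W w2 -> W w3 ->
    cross p q (yp w1) (yp (f w1)) (yp w2) (yp (f w2)) (yp w3) (yp (f w3)) = 0.
  move=> Uw1 Ww2 Ww3; apply: (vanish_dense (T := fun v =>
    cross p q (ypart (v true)) (ypart (v false)) (yp w2) (yp (f w2)) (yp w3) (yp (f w3)))
    _ _ oW W0 _ Uw1) => [m h|s v s0|w Ww]; last exact: H.
    pose C (u : 'cV[k]_2) := map_mx (@mpolyC m k) u.
    exists (cross (C p) (C q) (ypart (\row_l h true l)) (ypart (\row_l h false l))
      (C (yp w2)) (C (yp (f w2))) (C (yp w3)) (C (yp (f w3)))) => v.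
    by rewrite cross_meval !map_meval_const !map_meval_ypart.
  (* Scalings by 1 on the fixed vectors bring the expression to the shape of [crossZ]. *)
  rewrite !ypartZ -[yp w2]scale1r -[yp (f w2)]scale1r -[yp w3]scale1r.
  by rewrite -[yp (f w3)]scale1r crossZ !scale1r !mulr1 mulf_eq0 neq0.
have H2 w1 w2 w3 : U w1 -> U w2 -> W w3 ->
    cross p q (yp w1) (yp (f w1)) (yp w2) (yp (f w2)) (yp w3) (yp (f w3)) = 0.
  move=> Uw1 Uw2 Ww3; apply: (vanish_dense (T := fun v =>
    cross p q (yp w1) (yp (f w1)) (ypart (v true)) (ypart (v false)) (yp w3) (yp (f w3)))
    _ _ oW W0 _ Uw2) => [m h|s v s0|w Ww]; last exact: H1.
    pose C (u : 'cV[k]_2) := map_mx (@mpolyC m k) u.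
    exists (cross (C p) (C q) (C (yp w1)) (C (yp (f w1)))
      (ypart (\row_l h true l)) (ypart (\row_l h false l))
      (C (yp w3)) (C (yp (f w3)))) => v.
    by rewrite cross_meval !map_meval_const !map_meval_ypart.
  rewrite !ypartZ -[yp w1]scale1r -[yp (f w1)]scale1r -[yp w3]scale1r.
  by rewrite -[yp (f w3)]scale1r crossZ !scale1r !mulr1 mul1r mulf_eq0 neq0.
move=> w1 w2 w3 Uw1 Uw2 Uw3; apply: (vanish_dense (T := fun v =>
  cross p q (yp w1) (yp (f w1)) (yp w2) (yp (f w2)) (ypart (v true)) (ypart (v false)))
  _ _ oW W0 _ Uw3) => [m h|s v s0|w Ww]; last exact: H2.
  pose C (u : 'cV[k]_2) := map_mx (@mpolyC m k) u.
  exists (cross (C p) (C q) (C (yp w1)) (C (yp (f w1)))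
    (C (yp w2)) (C (yp (f w2)))
    (ypart (\row_l h true l)) (ypart (\row_l h false l))) => v.
  by rewrite cross_meval !map_meval_const !map_meval_ypart.
rewrite !ypartZ -[yp w1]scale1r -[yp (f w1)]scale1r -[yp w2]scale1r.
by rewrite -[yp (f w2)]scale1r crossZ !scale1r !mulr1 !mul1r mulf_eq0 neq0.
Qed.

End CrossDense.

(** On the maps acting by some homography [N] on the second coordinate, this
    says that [N] sends the point [p] to the point [q]. *)
Definition sends (p q : 'cV[k]_2) : set Bir := [set b | exists W : set P2,
  [/\ zopen W, W !=set0, W `<=` bdom (repr b)
    & forall w1 w2 w3, W w1 -> W w2 -> W w3 ->
      cross p q (yp w1) (yp (repr b w1)) (yp w2) (yp (repr b w2))
        (yp w3) (yp (repr b w3)) = 0]].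

Lemma sends_acts b N p q : bir_acts b N ->
  sends p q b <-> bracket (N *m p) q = 0.
Proof.
move=> [uN [W [oW W0 WD HW]]]; split=> [[V [oV V0 VD HV]]|e].
  have oWV := zopenI oW oV; have WV0 := projspace_meet oW oV W0 V0.
  have [w1 [Ww1 Vw1]] := WV0; have [y1 [t1 t10 e1]] := HW _ Ww1.
  (* The three points are chosen with distinct second coordinates, so that the factor of
     [bracket (N *m p) q] in [cross_acts] is nonzero. *)
  have [|w2 [Ww2 Vw2] b2] := @meet_ybrackets _ [:: yp w1] oWV WV0.
    by move=> u; rewrite inE => /eqP->.
  have [y2 [t2 t20 e2]] := HW _ Ww2.
  have [|w3 [Ww3 Vw3] b3] := @meet_ybrackets _ [:: yp w1; yp w2] oWV WV0.
    by move=> u; rewrite !inE => /orP[]/eqP->.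
  have [y3 [t3 t30 e3]] := HW _ Ww3.
  have := HV _ _ _ Vw1 Vw2 Vw3; rewrite e1 e2 e3.
  rewrite -[X in cross _ _ X _ _ _ _ _]scale1r.
  rewrite -[X in cross _ _ _ _ X _ _ _]scale1r.
  rewrite -[X in cross _ _ _ _ _ _ X _]scale1r.
  rewrite crossZ cross_acts => /eqP.
  rewrite !mul1r !mulf_eq0 (negPf t10) (negPf t20) (negPf t30) /=.
  rewrite (negPf (b2 _ _)) ?mem_head // (negPf (b3 _ _)) ?mem_head //.
  rewrite (negPf (b3 _ _)) ?inE ?eqxx ?orbT //.
  by move: uN; rewrite unitmxE unitfE => /negPf-> /eqP.
exists W; split=> // w1 w2 w3 Ww1 Ww2 Ww3.
have [_ [t1 _ ->]] := HW _ Ww1; have [_ [t2 _ ->]] := HW _ Ww2.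
have [_ [t3 _ ->]] := HW _ Ww3.
rewrite -[X in cross _ _ X _ _ _ _ _]scale1r.
rewrite -[X in cross _ _ _ _ X _ _ _]scale1r.
rewrite -[X in cross _ _ _ _ _ _ X _]scale1r.
by rewrite crossZ cross_acts e !mulr0.
Qed.

(** The complement is open in any family: three points where [cross] is nonzero for the parameter
    [a] stay in the domain and keep [cross] nonzero for nearby parameters. By [cross_dense] one
    nonzero value prevents [cross] from vanishing on a nonempty open set. *)
Lemma sends_closed p q : closed (sends p q).
Proof.
rewrite bir_closedE => A vA iA b [U [V [f [g [oU oV sU sV [iso f1 bE]]]]]].
have [fK gK rf rg] := iso.
pose F a w := (f (a, w)).2.
have rF a : regular_on [set w | U (a, w)] (F a) by exact: regular_slice.
have oUa a : zopen [set w | U (a, w)] by exact: zopen_slice.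
suff : zopen (~` (b @^-1` sends p q)) by rewrite /zopen setCK.
apply: zopen_locally => a /= nba.
have [w1 [w2 [w3 [Uw1 Uw2 Uw3 cw]]]] : exists w1 w2 w3,
    [/\ U (a, w1), U (a, w2), U (a, w3) &
    cross p q (yp w1) (yp (F a w1)) (yp w2) (yp (F a w2)) (yp w3) (yp (F a w3)) != 0].
  (* Without such points, the open set where [b a] coincides with the fibre of [f] would show that
     [b a] belongs to [sends p q]. *)
  apply: contrapT => nex; apply: nba; have [W [oW W0 WD WE]] := bE a.
  exists W; split=> // [w /WD[]//|w1 w2 w3 Ww1 Ww2 Ww3].
  rewrite !WE //; apply/eqP/negPn/negP => cw; apply: nex; exists w1, w2, w3.
  by split=> //; [case: (WD _ Ww1)|case: (WD _ Ww2)|case: (WD _ Ww3)].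
pose w_ (i : 'I_3) : P2 := nth w1 [:: w1; w2; w3] i.
pose D : set A := [set a | U (a, w1)] `&` [set a | U (a, w2)] `&` [set a | U (a, w3)].
pose T (v : 'I_3 -> 'rV[k]_3) : k := cross p q (yp w1) (ypart (v 0))
  (yp w2) (ypart (v 1)) (yp w3) (ypart (v ord_max)).
have oD : zopen D by do !apply: zopenI; exact: zopen_sliceP.
exists [set a | D a /\ T (fun i => hcoord (F a (w_ i))) != 0]; split.
- apply: (zopen_neq0 (f := fun i a => F a (w_ i))) => // [i|m h|s v s0].
  + apply: (@regular_sub _ _ _ [set a | U (a, w_ i)]); last exact: regular_sliceP.
    by move=> a' [[? ?] ?]; rewrite /w_; case: i => [[|[|[|]]]].
  + pose C (u : 'cV[k]_2) := map_mx (@mpolyC m k) u.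
    exists (cross (C p) (C q) (C (yp w1)) (ypart (\row_l h 0 l))
      (C (yp w2)) (ypart (\row_l h 1 l))
      (C (yp w3)) (ypart (\row_l h ord_max l))) => v.
    by rewrite cross_meval !map_meval_const !map_meval_ypart.
  + rewrite /T !ypartZ -[yp w1]scale1r -[yp w2]scale1r -[yp w3]scale1r.
    rewrite crossZ !scale1r !mul1r !mulf_eq0.
    by rewrite (negPf (s0 _)) (negPf (s0 _)) (negPf (s0 _)).
- by [].
move=> a' [[[Ua1 Ua2] Ua3] Ta'] /= [W [oW W0 WD HW]].
have [V' [oV' V'0 V'D HV']] := bE a'.
move/eqP: Ta'; apply; apply: (@cross_dense _ (F a') (oUa a') (rF a') _ _ (W `&` V')) => //.
- exact: zopenI.
- exact: projspace_meet.
- by move=> w [_ /V'D[]].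
- move=> x1 x2 x3 [Wx1 Vx1] [Wx2 Vx2] [Wx3 Vx3].
  by rewrite /F -!HV' //; exact: HW.
Qed.

Lemma sends_bigclosed v (us : seq 'cV[k]_2) :
  closed [set b | exists2 u, u \in us & sends v u b].
Proof.
elim: us => [|u us IH].
  have -> : [set b | exists2 u, u \in [::] & sends v u b] = set0.
    by apply/seteqP; split=> b // [].
  exact: closed0.
rewrite (_ : [set b | _] = sends v u `|` [set b | exists2 u, u \in us & sends v u b]).
  by apply: closedU => //; exact: sends_closed.
apply/seteqP; split=> b.
  by move=> [u']; rewrite inE => /orP[/eqP->|u'us]; [left|right; exists u'].
by move=> [?|[u' u'us ?]]; [exists u|exists u']; rewrite // inE ?eqxx ?u'us ?orbT.
Qed.

(** The stabilizer of [v] in [G] contains 1, is closed, and is open because its complement in [G] is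
    a finite union of closed sets [sends v u]. *)
Lemma connected_fixes_finite_orbit (G : set Bir) (v : 'cV[k]_2) (us : seq 'cV[k]_2) :
  is_subgroup G -> connected G -> (forall g, G g -> exists N, bir_acts g N) ->
  v != 0 -> (forall u, u \in us -> u != 0) ->
  (forall g N, G g -> bir_acts g N ->
    exists2 u, u \in us & bracket (N *m v) u = 0) ->
  forall g N, G g -> bir_acts g N -> bracket (N *m v) v = 0.
Proof.
move=> [G1 _ _] cG actG v0 us0 orb g N Gg gN; apply/(sends_acts v v gN).
(* Only the candidates different from [v] as points of the projective line are kept. *)
pose us' := [seq u <- us | bracket u v != 0].
pose O : set Bir := ~` [set b | exists2 u, u \in us' & sends v u b].
suff E : G `&` sends v v = G by move: Gg; rewrite -E => -[].
apply: cG.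
- exists 1%g; split=> //; apply/(sends_acts v v bir_acts1).
  by rewrite mul1mx bracketuu.
- exists O; first by rewrite openC; exact: sends_bigclosed.
  apply/seteqP; split=> b [Gb]; have [M bM] := actG _ Gb.
    move=> /(sends_acts v v bM) bv; split=> // -[u].
    rewrite mem_filter => /andP[uv _] /(sends_acts v u bM) bu.
    have uM := bir_acts_unit bM.
    have Mv0 : M *m v != 0.
      by apply: contraNneq v0 => e; rewrite -[v](mulKmx uM) e mulmx0.
    have [s sE] := bracket_eq0 Mv0 bv; have [t tE] := bracket_eq0 Mv0 bu.
    by move: uv; rewrite tE [X in bracket _ X]sE bracketZl bracketZr bracketuu !mulr0 eqxx.
  move=> Ob; split=> //; apply/(sends_acts v v bM).
  have [u uus bu] := orb _ _ Gb bM.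
  have [uv|uv] := eqVneq (bracket u v) 0.
    have u0 := us0 _ uus.
    have [t ->] : exists t, M *m v = t *: u.
      by apply: bracket_eq0 => //; rewrite bracketC bu oppr0.
    have [s ->] := bracket_eq0 u0 uv.
    by rewrite bracketZl bracketZr bracketuu !mulr0.
  case: Ob; exists u; first by rewrite mem_filter uv.
  exact/(sends_acts v u bM).
- by exists (sends v v) => //; exact: sends_closed.
Qed.

Lemma connected_solvable_fixes_line (G : set Bir) :
  is_subgroup G -> connected G -> is_solvable G ->
  (forall g, G g -> exists N, bir_acts g N) ->
  exists2 v : 'cV[k]_2, v != 0 &
    forall g N, G g -> bir_acts g N -> bracket (N *m v) v = 0.
Proof.
move=> sG cG soG actG; apply: (solvable_fixes_line sG soG).
- exact: bir_acts_unit.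
- exact: bir_acts1.
- exact: bir_acts_uniq.
- exact: bir_actsM.
- exact: bir_actsV.
- by move=> v us v0 us0; exact: connected_fixes_finite_orbit.
Qed.

End ActionOnLines.

(** * Homographies and rational functions *)

Section Homographies.
Variable k : closedFieldType.
Implicit Types (M N K : 'M[k]_2) (p q : {poly k}) (x y : k).

(** Formulas for maps are compared up to finitely many [y]: this discards poles, and zeros of chosen
    denominators, and still leaves a nonempty open set of the plane. *)
Definition cofinitely (P : k -> Prop) : Prop :=
  exists s : seq k, forall y, y \notin s -> P y.

Lemma cofinitelyI (P Q : k -> Prop) :
  cofinitely P -> cofinitely Q -> cofinitely (fun y => P y /\ Q y).
Proof.
move=> [s sP] [t tQ]; exists (s ++ t) => y.
by rewrite mem_cat negb_or => /andP[/sP ? /tQ].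
Qed.

Lemma cofinitely_sub (P Q : k -> Prop) :
  (forall y, P y -> Q y) -> cofinitely P -> cofinitely Q.
Proof. by move=> PQ [s sP]; exists s => y /sP/PQ. Qed.

Lemma cofinitely_nonroot p : p != 0 -> cofinitely (fun y => p.[y] != 0).
Proof.
move=> p0; have [s pE] := closed_field_poly_normal p; exists s => y ys.
apply: contraNN ys => /eqP py; have : root p y by apply/eqP.
by rewrite pE rootZ ?lead_coef_eq0 // root_prod_XsubC.
Qed.

Definition mden N y : k := N 1 0 * y + N 1 1.

Lemma moebiusE N y : moebius N y = (N 0 0 * y + N 0 1) / mden N y.
Proof. by []. Qed.

Definition mden_poly N : {poly k} := N 1 0 *: 'X + (N 1 1)%:P.

Lemma mden_polyE N y : (mden_poly N).[y] = mden N y.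
Proof. by rewrite /mden_poly hornerD hornerZ hornerX hornerC. Qed.

Lemma det_neq0 N : N \in unitmx -> N 0 0 * N 1 1 - N 0 1 * N 1 0 != 0.
Proof. by rewrite unitmxE unitfE det2. Qed.

Lemma mden_poly_neq0 N : N \in unitmx -> mden_poly N != 0.
Proof.
move=> /det_neq0; apply: contraNneq => N0.
have e0 := mden_polyE N 0; have e1 := mden_polyE N 1.
move: e0 e1; rewrite N0 !horner0 /mden mulr0 add0r mulr1 => e0.
by rewrite -e0 addr0 => <-; rewrite !mulr0 subr0.
Qed.

Lemma mden_cofinite N : N \in unitmx -> cofinitely (fun y => mden N y != 0).
Proof.
move=> /mden_poly_neq0/cofinitely_nonroot; apply: cofinitely_sub => y.
by rewrite mden_polyE.
Qed.

Lemma mden_mul M N y : mden N y != 0 ->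
  mden (M *m N) y = mden M (moebius N y) * mden N y.
Proof. by move=> y0; rewrite /mden moebiusE !mulmx22E; rewrite /mden in y0 *; field. Qed.

(** A pole of the composite is harmless: both sides are then divisions by zero, with value 0. *)
Lemma moebius_mul M N y : mden N y != 0 ->
  moebius M (moebius N y) = moebius (M *m N) y.
Proof.
move=> y0; rewrite moebiusE [RHS]moebiusE mden_mul //.
have -> : (M *m N) 0 0 * y + (M *m N) 0 1 =
    (M 0 0 * moebius N y + M 0 1) * mden N y.
  by rewrite moebiusE !mulmx22E; rewrite /mden in y0 *; field.
by rewrite -mulf_div divff ?mulr1.
Qed.

Lemma moebius1 y : moebius 1%:M y = y.
Proof. by rewrite /moebius !mxE /= !mul1r mul0r add0r addr0 divr1. Qed.

Lemma mden1 y : mden 1%:M y = 1.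
Proof. by rewrite /mden !mxE /= mul0r add0r. Qed.

Lemma moebiusK N y : N \in unitmx -> mden N y != 0 ->
  moebius (invmx N) (moebius N y) = y.
Proof. by move=> uN y0; rewrite moebius_mul // mulVmx // moebius1. Qed.

Lemma mdenV_neq0 N y : N \in unitmx -> mden N y != 0 ->
  mden (invmx N) (moebius N y) != 0.
Proof.
move=> uN y0; have := mden_mul (invmx N) y0; rewrite mulVmx // mden1 => e.
by apply: contraNneq (oner_neq0 k) => e0; rewrite e e0 mul0r.
Qed.

(** Take the preimage under [K] of a point that is neither a root of [p] nor the pole of the inverse
    homography. *)
Lemma moebius_nonroot K p : K \in unitmx -> p != 0 ->
  exists2 y, mden K y != 0 & p.[moebius K y] != 0.
Proof.
move=> uK p0; have uV : invmx K \in unitmx by rewrite unitmx_inv.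
have /closed_nonrootP[x] : p * mden_poly (invmx K) != 0.
  by rewrite mulf_neq0 // mden_poly_neq0.
rewrite rootM negb_or /root mden_polyE => /andP[px Kx].
have := moebiusK uV Kx; have := mdenV_neq0 uV Kx; rewrite invmxK => dx xE.
by exists (moebius (invmx K) x) => //; rewrite xE.
Qed.

(** The homogenization of [p], of degree [d], composed with the linear map [K]. *)
Definition hsubst K d p : {poly k} := \sum_(i < d)
  p`_i *: ((K 0 0 *: 'X + (K 0 1)%:P) ^+ i * mden_poly K ^+ (d - i)).

Lemma hsubstE K d p y : (size p <= d)%N -> mden K y != 0 ->
  (hsubst K d p).[y] = mden K y ^+ d * p.[moebius K y].
Proof.
move=> pd y0; rewrite (horner_coef_wide _ pd) mulr_sumr horner_sum.
apply: eq_bigr => i _; rewrite hornerZ hornerM !horner_exp mden_polyE.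
rewrite hornerD hornerZ hornerX hornerC [RHS]mulrCA; congr (_ * _).
rewrite moebiusE expr_div_n [RHS]mulrCA; congr (_ * _).
have -> : mden K y ^+ d = mden K y ^+ (d - i) * mden K y ^+ i.
  by rewrite -exprD subnK // ltnW.
by rewrite mulfK ?expf_neq0.
Qed.

Lemma hsubst_neq0 K d p : K \in unitmx -> (size p <= d)%N -> p != 0 ->
  hsubst K d p != 0.
Proof.
move=> uK pd p0; have [y y0 py] := moebius_nonroot uK p0.
apply: contraTneq py => h0; rewrite negbK.
have := hsubstE pd y0; rewrite h0 horner0 => /esym/eqP.
by rewrite mulf_eq0 expf_eq0 (negPf y0) andbF.
Qed.

End Homographies.

(** * Evaluating rational functions and substituting a homography in them *)

Section Fractions.
Variable k : closedFieldType.
Local Notation F := {fraction {poly k}}.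
Local Notation "p %:F" := (@FracField.tofrac {poly k} p).

Lemma fractionE (r : F) : r = (\n_(repr r))%:F / (\d_(repr r))%:F.
Proof.
have d0 : \d_(repr r) != 0 by exact: denom_ratioP.
apply: (canRL (mulfK _)); first by rewrite tofrac_eq0.
rewrite -{1}[r]reprK; unlock FracField.tofrac; rewrite -[LHS]FracField.pi_mul.
apply/eqmodP; rewrite /= /FracField.equivf /FracField.mulf.
by rewrite !numden_Ratio ?mulr1 ?oner_neq0 // mulrC.
Qed.

Lemma frac_eval_div p q : q != 0 ->
  cofinitely (fun y => frac_eval (p%:F / q%:F) y = p.[y] / q.[y]).
Proof.
move=> q0; set r := p%:F / q%:F.
have d0 : \d_(repr r) != 0 by exact: denom_ratioP.
have e : \n_(repr r) * q = p * \d_(repr r).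
  apply/eqP; rewrite -tofrac_eq !tofracM; apply/eqP.
  have := fractionE r; rewrite {1}/r => /eqP.
  by rewrite eqr_div ?tofrac_eq0 // => /eqP ->.
apply: cofinitely_sub (cofinitelyI (cofinitely_nonroot q0) (cofinitely_nonroot d0)).
move=> y [qy dy]; apply/eqP; rewrite /frac_eval eqr_div //.
by rewrite -!hornerM e.
Qed.

(** Clearing denominators in the determinant makes invertibility over the function field testable by
    evaluating a polynomial. *)
Lemma unit_fraction_mx (M : 'M[F]_2) (n d : 'I_2 -> 'I_2 -> {poly k}) :
  (forall i j, d i j != 0) -> (forall i j, M i j = (n i j)%:F / (d i j)%:F) ->
  (M \in unitmx) =
  (n 0 0 * n 1 1 * (d 0 1 * d 1 0) - n 0 1 * n 1 0 * (d 0 0 * d 1 1) != 0).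
Proof.
move=> d0 ME; rewrite unitmxE unitfE det2 !ME -[in RHS]tofrac_eq0.
have D0 i j : (d i j)%:F != 0 by rewrite tofrac_eq0.
rewrite !mulf_div -mulNr addf_div; try exact: mulf_neq0.
rewrite mulf_eq0 invr_eq0 [X in _ || X]mulf_eq0 ![_%:F * _%:F == 0]mulf_eq0.
by rewrite !(negPf (D0 _ _)) !orbF tofracB !tofracM mulNr.
Qed.

(** This is the action of [PGL_2] on [PGL_2(k(y))] by change of the variable [y], which defines the
    semidirect product. *)
Lemma moebius_subst (M : 'M[F]_2) (K : 'M[k]_2) : M \in unitmx -> K \in unitmx ->
  exists2 M' : 'M[F]_2, M' \in unitmx &
    cofinitely (fun y => forall x,
      moebius_frac M' y x = moebius_frac M (moebius K y) x).
Proof.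
move=> uM uK.
pose n i j := \n_(repr (M i j)); pose d i j := \d_(repr (M i j)).
have d0 i j : d i j != 0 by exact: denom_ratioP.
(* With one degree for all numerators and denominators, the factors [mden K y ^+ D] cancel in every
   quotient. *)
pose D := (\max_i \max_j maxn (size (n i j)) (size (d i j)))%N.
have nD i j : (size (n i j) <= D)%N.
  by rewrite (bigmax_sup i) // (bigmax_sup j) // leq_maxl.
have dD i j : (size (d i j) <= D)%N.
  by rewrite (bigmax_sup i) // (bigmax_sup j) // leq_maxr.
have hd0 i j : hsubst K D (d i j) != 0 by exact: hsubst_neq0.
exists (\matrix_(i, j) ((hsubst K D (n i j))%:F / (hsubst K D (d i j))%:F)).
  rewrite (unit_fraction_mx (n := fun i j => hsubst K D (n i j)) hd0) => [|i j]; last by rewrite mxE.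
  have ME i j : M i j = (n i j)%:F / (d i j)%:F by exact: fractionE.
  have [y y0] := moebius_nonroot uK (etrans (esym (unit_fraction_mx d0 ME)) uM).
  apply: contraNneq => /(congr1 (horner^~ y)).
  rewrite !(hornerD, hornerN, hornerM) horner0 !hsubstE //.
  set t := mden K y ^+ D => e; have t0 : t != 0 by rewrite expf_neq0.
  (* Each term of the cleared determinant is a product of four entries, each contributing a factor
     [t]. *)
  apply/eqP/(mulfI (expf_neq0 4 t0)); rewrite mulr0 -e; ring.
have H i j : cofinitely (fun y =>
    frac_eval ((hsubst K D (n i j))%:F / (hsubst K D (d i j))%:F) y =
    frac_eval (M i j) (moebius K y)).
  apply: cofinitely_sub
    (cofinitelyI (mden_cofinite uK) (frac_eval_div (hsubst K D (n i j)) (hd0 i j))).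
  move=> y [y0 ->]; rewrite !hsubstE // -mulf_div divff ?mul1r //.
  by rewrite expf_neq0.
apply: cofinitely_sub (cofinitelyI (cofinitelyI (H 0 0) (H 0 1))
  (cofinitelyI (H 1 0) (H 1 1))) => y [[e00 e01] [e10 e11]] x.
by rewrite /moebius_frac /moebius !mxE e00 e01 e10 e11.
Qed.

End Fractions.

(** * Birational maps of the affine plane *)

Section AffinePlane.
Variable k : closedFieldType.
Local Notation P2 := (projspace k 2).
Local Notation Bir := (Bir k).
Local Notation yp w := (ypart (hcoord w)).
Implicit Types (F G : k * k -> k * k) (b c : Bir) (z : k * k).

Let cP : covered P2 := @projspace_covered k 2.

Lemma hcoord_inj (v w : P2) (t : k) : t != 0 -> hcoord v = t *: hcoord w -> v = w.
Proof.
move=> t0 e; have [_ inj _ _ _] := projspace_variety k 2.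
have [j jw] := rV_neq0 (hcoord_neq0 w).
have jv : hcoord v 0 j != 0 by rewrite e mxE mulf_neq0.
apply: (inj j); rewrite ?inE //; apply/rowP => l.
by rewrite !mxE e !mxE -mulf_div divff ?mul1r.
Qed.

Definition aff (w : P2) : k * k :=
  (hcoord w 0 0 / hcoord w 0 ord_max, hcoord w 0 1 / hcoord w 0 ord_max).

Lemma affine_pointK z : aff (affine_point z) = z.
Proof.
have [c c0 cE] := hcoord_hline (affine_vec_neq0 z).
rewrite /aff cE !mxE /= -!mulf_div divff // !mul1r !divr1; by case: z {cE}.
Qed.

Lemma affine_point_inj : injective (@affine_point k).
Proof. exact: can_inj affine_pointK. Qed.

Lemma affK (w : P2) : hcoord w 0 ord_max != 0 -> affine_point (aff w) = w.
Proof.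
move=> w0; have [c c0 cE] := hcoord_hline (affine_vec_neq0 (aff w)).
apply: (@hcoord_inj _ _ (c / hcoord w 0 ord_max)); first by rewrite mulf_neq0 ?invr_neq0.
rewrite cE -scalerA; congr (_ *: _); apply/rowP => i; rewrite !mxE.
case: i => [[|[|[|//]]] lt] /=; rewrite [RHS]mulrC.
- by congr (hcoord w _ _ / _); exact/val_inj.
- by congr (hcoord w _ _ / _); exact/val_inj.
- by rewrite (_ : Ordinal lt = ord_max) ?divff //; exact/val_inj.
Qed.

Lemma hcoord_affine z : exists2 t, t != 0 & hcoord (affine_point z) = t *: affine_vec z.
Proof. exact: hcoord_hline. Qed.

Lemma ypart_affine z : ypart (affine_vec z) = col2 z.2 1.
Proof. by apply/colP; apply: ord2E; rewrite !mxE. Qed.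

(** Complement of the line at infinity and of finitely many lines [y = c]; it turns cofinite
    conditions on [y] into open sets of the plane. *)
Definition affine_off (s : seq k) : set P2 :=
  [set w | hcoord w 0 ord_max != 0 /\ (aff w).2 \notin s].

Lemma bracket_col2_10 (w : P2) : bracket (col2 1 0) (yp w) = hcoord w 0 ord_max.
Proof. by rewrite /bracket !mxE /= mul1r mul0r subr0. Qed.

Lemma affine_off_spec s : zopen (affine_off s) /\ affine_off s !=set0.
Proof.
elim: s => [|y s [os s0]].
  have -> : affine_off [::] = [set w | bracket (col2 1 0) (yp w) != 0].
    by apply/seteqP; split=> w; rewrite /affine_off /= bracket_col2_10 // => -[].
  by split; [exact: zopen_ybracket|exact/ybracket_neq0/col2_1l_neq0].
have -> : affine_off (y :: s) =
    affine_off s `&` [set w | bracket (col2 y 1) (yp w) != 0].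
  have E w : hcoord w 0 ord_max != 0 ->
      (bracket (col2 y 1) (yp w) == 0) = ((aff w).2 == y).
    move=> w0; rewrite /bracket !mxE /= mul1r subr_eq0 eq_sym.
    by rewrite (can2_eq (divfK w0) (mulfK w0)).
  apply/seteqP; split=> w; rewrite /affine_off /= inE negb_or.
    by move=> [w0 /andP[wy ws]]; rewrite E.
  by move=> [[w0 ws]]; rewrite E // => ->.
split; first by apply: zopenI => //; exact: zopen_ybracket.
by apply: projspace_meet => //; [exact: zopen_ybracket|exact/ybracket_neq0/col2_1r_neq0].
Qed.

Lemma affine_off_point s z : affine_off s (affine_point z) -> z.2 \notin s.
Proof. by move=> []; rewrite affine_pointK. Qed.

Lemma bir_affine_pi r F : (exists W : set P2, [/\ zopen W, W !=set0, W `<=` bdom r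
    & forall z, W (affine_point z) -> r (affine_point z) = affine_point (F z)]) ->
  bir_affine (\pi_Bir r)%qT F.
Proof.
move=> [W [oW W0 WD HW]]; have [V [oV V0 VD HV]] := bir_reprK r.
exists (V `&` W); split; [exact: zopenI|exact: projspace_meet| |].
- by move=> w [/VD[]].
- by move=> z [Vz Wz]; rewrite HV // HW.
Qed.

Lemma bir_affine_mul b c F G : bir_affine b F -> bir_affine c G ->
  bir_affine (b * c)%g (F \o G).
Proof.
move=> [W [oW W0 WD HW]] [V [oV V0 VD HV]].
apply: (@bir_affine_pi (birep_comp (repr b) (repr c))).
have oS : zopen (bdom (repr c) `&` repr c @^-1` W).
  by apply: zopen_preimage => //; [exact: bdom_open|case: (birep_iso (repr c))].
exists ((bdom (repr c) `&` repr c @^-1` W) `&` V); split.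
- exact: zopenI.
- by apply: projspace_meet => //; exact: bcod_meet.
- by move=> w [[cw Wcw] _]; split=> //; exact: WD.
- by move=> z [[cz Wcz] Vz] /=; move: Wcz; rewrite /= HV // => /HW.
Qed.

Lemma bir_affine_eq b F G : cofinitely (fun y => forall x, F (x, y) = G (x, y)) ->
  bir_affine b F -> bir_affine b G.
Proof.
move=> [s FG] [W [oW W0 WD HW]]; have [os s0] := affine_off_spec s.
exists (W `&` affine_off s); split; [exact: zopenI|exact: projspace_meet| |].
- by move=> w [/WD].
- by move=> z [/HW -> /affine_off_point]; case: z => x y /FG ->.
Qed.

(** On the open set used for the inverse, every affine point is the image under [F] of a point
    [(x, y)] with [y] off the exceptional set. *)
Lemma bir_affine_inv b F G : cofinitely (fun y => forall x, G (F (x, y)) = (x, y)) ->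
  bir_affine b F -> bir_affine b^-1%g G.
Proof.
move=> [s GF] [W [oW W0 WD HW]]; have [os s0] := affine_off_spec s.
apply: (@bir_affine_pi (birep_inv (repr b))).
have [w0 [Ww0 sw0]] := projspace_meet oW os W0 s0.
exists (bcod (repr b) `&` binv (repr b) @^-1` (W `&` affine_off s)); split.
- apply: zopen_preimage => //; [exact: bcod_open|by case: (birep_iso (repr b))|].
  exact: zopenI.
- by have [cw e] := bdomK (WD _ Ww0); exists (repr b w0); split=> //=; rewrite e.
- by move=> w [].
move=> z [/bcodK[dz e] [Wz sz]] /=; move: e Wz sz {dz}.
set w := binv _ _ => e Ww sw; have wE := affK sw.1.
move: sw e; rewrite -wE in Ww *; move=> /affine_off_point ys.
rewrite HW // => /affine_point_inj <-; congr affine_point.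
by move: ys; case: (aff w) => x y /GF.
Qed.

Definition homography (N : 'M[k]_2) (z : k * k) : k * k := (z.1, moebius N z.2).

Section Homography.
Variable N : 'M[k]_2.
Hypothesis uN : N \in unitmx.

(** The two brackets are the homogeneous equations of the line at infinity and of the polar line of
    [N]. *)
Definition homography_dom : set P2 := [set w | bracket (col2 1 0) (yp w) != 0] `&`
  [set w | bracket (col2 (N 1 1) (- N 1 0)) (yp w) != 0].

Definition homography_fun (w : P2) : P2 := affine_point (homography N (aff w)).

Local Notation D := homography_dom.
Local Notation f := homography_fun.

Lemma homography_domE w :
  D w <-> hcoord w 0 ord_max != 0 /\ mden N (aff w).2 != 0.
Proof.
rewrite /homography_dom /= bracket_col2_10.
have E : bracket (col2 (N 1 1) (- N 1 0)) (yp w) =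
    N 1 0 * hcoord w 0 1 + N 1 1 * hcoord w 0 ord_max.
  by rewrite /bracket !mxE /=; ring.
have H : hcoord w 0 ord_max != 0 -> (mden N (aff w).2 == 0) =
    (bracket (col2 (N 1 1) (- N 1 0)) (yp w) == 0).
  move=> w0; rewrite E -[RHS](mulIr_eq0 _ (mulIf (invr_neq0 w0))); congr (_ == 0).
  by rewrite /mden /=; field.
by split=> -[w0 w1]; split=> //; rewrite ?H // -H.
Qed.

Lemma homography_dom_open : zopen D.
Proof. by apply: zopenI; exact: zopen_ybracket. Qed.

Lemma homography_dom_neq0 : D !=set0.
Proof.
have [s sN] := mden_cofinite uN; have [_ [w [w0 ws]]] := affine_off_spec s.
by exists w; apply/homography_domE; split=> //; exact: sN.
Qed.

Lemma homography_regular : regular_on D f.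
Proof.
apply/regular_hcoord => w i Dw iw.
have [q [h [qw H]]] := (regular_hcoord _ _).1 (@regular_projspace_id k 2) w i I iw.
pose d := N 1 0 *: h 1 + N 1 1 *: h ord_max.
(* Homogeneous form of the map: [[x : y : z]] goes to [[x d : (N 0 0 y + N 0 1 z) z : d z]] with
   [d = N 1 0 y + N 1 1 z]. *)
exists q, (fun m : 'I_3 => [:: h 0 * d; (N 0 0 *: h 1 + N 0 1 *: h ord_max) * h ord_max;
  d * h ord_max]`_m); split=> // w' Dw' iw' qw'.
have [t t0] := H _ I iw' qw'; move: (chart i w' 0) => e tE {qw' iw'}.
have [w0 w1] := (homography_domE w').1 Dw'.
have [c c0 cE] := hcoord_affine (homography N (aff w')).
have := w0; rewrite tE mulf_eq0 negb_or => /andP[_ h2].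
have d0 : d.@[e] != 0.
  apply: contraNneq w1; rewrite /d mevalD !mevalZ => d0; apply/eqP.
  rewrite /mden /= !tE -[RHS](mul0r (h ord_max).@[e]^-1) -d0; field.
  by rewrite h2.
exists (c / (d.@[e] * (h ord_max).@[e])).
  by rewrite mulf_neq0 ?invr_neq0 ?mulf_neq0.
have dE : d.@[e] =
    N 1 0 * (h 1).@[e] + N 1 1 * (h ord_max).@[e].
  by rewrite /d mevalD !mevalZ.
move=> m; rewrite [hcoord _]cE !mxE /= /moebius.
have yE : (aff w').2 = (h 1).@[e] / (h ord_max).@[e].
  by rewrite /aff /= !tE -mulf_div (divff t0) mul1r.
have xE : (aff w').1 = (h 0).@[e] / (h ord_max).@[e].
  by rewrite /aff /= !tE -mulf_div (divff t0) mul1r.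
rewrite /= in xE yE; rewrite xE yE dE in d0 *.
case: m => [[|[|[|//]]] lt] /=; rewrite !mevalM ?dE ?mevalD ?mevalZ; field.
all: by rewrite ?h2 ?d0.
Qed.

End Homography.

Lemma hcoord_affine_neq0 z : hcoord (affine_point z) 0 ord_max != 0.
Proof. by have [t t0 ->] := hcoord_affine z; rewrite !mxE /= mulr1. Qed.

Lemma homography_funK N w : N \in unitmx -> homography_dom N w ->
  homography_dom (invmx N) (homography_fun N w) /\
  homography_fun (invmx N) (homography_fun N w) = w.
Proof.
move=> uN /homography_domE[w0 w1]; split.
  apply/homography_domE; rewrite affine_pointK; split.
    exact: hcoord_affine_neq0.
  exact: mdenV_neq0.
rewrite /homography_fun affine_pointK /homography /= moebiusK //.
exact: affK.
Qed.

Lemma homography_iso N : N \in unitmx ->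
  iso_on (homography_dom N) (homography_dom (invmx N))
    (homography_fun N) (homography_fun (invmx N)).
Proof.
move=> uN; have uV : invmx N \in unitmx by rewrite unitmx_inv.
split; [by move=> w; exact: homography_funK| |exact: homography_regular..].
by move=> w /(homography_funK uV); rewrite invmxK.
Qed.

Lemma homography_exists N : N \in unitmx -> exists g : Bir, bir_affine g (homography N).
Proof.
move=> uN.
pose r := Birep (homography_dom_open N) (homography_dom_open (invmx N))
  (homography_dom_neq0 uN) (homography_iso uN).
exists (\pi_Bir r)%qT; apply: bir_affine_pi; exists (homography_dom N).
split=> //; [exact: homography_dom_open|exact: homography_dom_neq0|].
by move=> z _; rewrite /= /homography_fun affine_pointK.
Qed.

Lemma homographyV g N : N \in unitmx ->
  bir_affine g (homography N) -> bir_affine g^-1%g (homography (invmx N)).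
Proof.
move=> uN; apply: bir_affine_inv.
apply: cofinitely_sub (mden_cofinite uN) => y y0 x.
by rewrite /homography /= moebiusK.
Qed.

Lemma mulmx_col2 N y : mden N y != 0 ->
  N *m col2 y 1 = mden N y *: col2 (moebius N y) 1 :> 'cV[k]_2.
Proof.
rewrite /mden => y0; apply/colP; apply: ord2E; rewrite mulmx2E !mxE /=.
  by rewrite moebiusE /mden; field.
by rewrite !mulr1.
Qed.

Lemma bir_affine_acts b F N : N \in unitmx -> (forall z, (F z).2 = moebius N z.2) ->
  bir_affine b F -> bir_acts b N.
Proof.
move=> uN FN [W [oW W0 WD HW]]; split=> //.
have [s sN] := mden_cofinite uN; have [os s0] := affine_off_spec s.
exists (W `&` affine_off s); split; [exact: zopenI|exact: projspace_meet| |].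
  by move=> w [/WD].
move=> w [Ww sw]; have wE := affK sw.1; have ys := sN _ sw.2; move: Ww ys.
move: (aff w) wE => z <- {sw} Wz z0.
have [t t0 tE] := hcoord_affine z; have [c c0 cE] := hcoord_affine (F z).
rewrite HW // tE cE !ypartZ !ypart_affine FN.
split; first by rewrite scaler_eq0 negb_or t0 col2_1r_neq0.
exists (c / (mden N z.2 * t)); first by rewrite mulf_neq0 ?invr_neq0 ?mulf_neq0.
rewrite -scalemxAr mulmx_col2 // !scalerA; congr (_ *: _).
by field; rewrite t0.
Qed.

End AffinePlane.

(** * Conjugation inside the Jonquieres group *)

Section Jonquieres.
Variable k : closedFieldType.
Local Notation Bir := (Bir k).

Lemma Jonq_acts (b : Bir) : Jonq k b -> exists N, bir_acts b N.
Proof. by move=> [M [N [_ uN bF]]]; exists N; exact: bir_affine_acts bF. Qed.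

(** Since [g] leaves [x] alone, the conjugate acts on [x] by [M] with the inverse homography of [K]
    substituted for [y]. *)
Lemma Jonq_conj (b g : Bir) M N K : M \in unitmx -> N \in unitmx -> K \in unitmx ->
  bir_affine b (fun z => (moebius_frac M z.2 z.1, moebius N z.2)) ->
  bir_affine g (homography K) ->
  exists2 M', M' \in unitmx & bir_affine (g * b * g^-1)%g
    (fun z => (moebius_frac M' z.2 z.1, moebius (K *m N *m invmx K) z.2)).
Proof.
move=> uM uN uK bF gK; have uV : invmx K \in unitmx by rewrite unitmx_inv.
have [M' uM' HM'] := moebius_subst uM uV; exists M' => //.
have := bir_affine_mul (bir_affine_mul gK bF) (homographyV uK gK).
apply: bir_affine_eq.
have uNV : N *m invmx K \in unitmx by rewrite unitmx_mul uN.
apply: cofinitely_sub (cofinitelyI HM'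
  (cofinitelyI (mden_cofinite uV) (mden_cofinite uNV))) => y [yM [y1 y2]] x.
rewrite /homography /= yM moebius_mul //; last first.
  by apply: contraNneq y2 => e; rewrite mden_mul // e mul0r.
by rewrite moebius_mul.
Qed.

Lemma Jonq_PGL2V (g : Bir) : Jonq_PGL2 k g -> Jonq_PGL2 k g^-1%g.
Proof.
move=> [N uN gN]; exists (invmx N); first by rewrite unitmx_inv.
exact: homographyV.
Qed.

Lemma conj_Jonq (g : Bir) G : Jonq_PGL2 k g -> G `<=` Jonq k ->
  conj_subgroup g G `<=` Jonq k.
Proof.
move=> [K uK gK] GJ _ [b /GJ[M [N [uM uN bF]]] <-].
have [M' uM' H] := Jonq_conj uM uN uK bF gK.
exists M', (K *m N *m invmx K); split=> //.
by rewrite !unitmx_mul uK uN unitmx_inv.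
Qed.

Lemma Jonq_Aff_sub : Jonq_Aff k `<=` Jonq k.
Proof.
move=> b [M [a [c [uM a0 bF]]]].
pose N : 'M[k]_2 := \matrix_i (if i == 0 then \row_j [:: a; c]`_j
  else \row_j [:: 0; 1]`_j).
exists M, N; split=> //; first by rewrite unitmxE unitfE det2 !mxE /= mulr1 mulr0 subr0.
apply: bir_affine_eq bF; exists [::] => y _ x.
by rewrite /moebius !mxE /= mul0r add0r divr1.
Qed.

Lemma connected_solvable_conj_Jonq_Aff (G : set Bir) :
  is_subgroup G -> connected G -> is_solvable G -> G `<=` Jonq k ->
  exists2 g, Jonq_PGL2 k g & conj_subgroup g G `<=` Jonq_Aff k.
Proof.
move=> sG cG soG GJ.
have [|v v0 vfix] := connected_solvable_fixes_line sG cG soG.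
  by move=> g /GJ; exact: Jonq_acts.
(* The vector [u] completes [v] to a basis; the rows of [K] below are the linear forms [bracket u]
   and [bracket v]. *)
have [u uv] : exists u, bracket u v != 0.
  have [h|h] := col2_neq0 v0; [exists (col2 0 1)|exists (col2 1 0)];
  by rewrite /bracket !mxE /= ?mul1r ?mul0r ?subr0 ?sub0r ?oppr_eq0.
(* [K] sends the fixed point [v] to the point at infinity of [P^1]. *)
pose K : 'M[k]_2 := \matrix_i (if i == 0 then \row_j [:: - u 1 0; u 0 0]`_j
  else \row_j [:: - v 1 0; v 0 0]`_j).
have uK : K \in unitmx.
  rewrite unitmxE unitfE det2 !mxE /=.
  by apply: contraNneq uv => e; apply/eqP; rewrite -[RHS]e /bracket; ring.
have Kv : K *m v = bracket u v *: col2 1 0.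
  by apply/colP; apply: ord2E; rewrite mulmx2E /bracket !mxE /=; ring.
have [g gK] := homography_exists uK; exists g; first by exists K.
move=> _ [b Gb <-]; have [M [N [uM uN bF]]] := GJ _ Gb.
have [M' uM' cF] := Jonq_conj uM uN uK bF gK.
move: cF; set N' := K *m N *m invmx K => cF.
have uN' : N' \in unitmx by rewrite !unitmx_mul uK uN unitmx_inv.
(* The conjugated homography fixes the point at infinity, the image of [v] under [K], hence is
   affine. *)
have N'0 : N' 1 0 = 0.
  have Nv : bracket (N *m v) v = 0 by apply: (vfix b) => //; exact: bir_affine_acts bF.
  have : bracket (N' *m (K *m v)) (K *m v) = 0.
    by rewrite /N' -!mulmxA mulKmx // bracketM Nv mulr0.
  rewrite Kv -scalemxAr bracketZl bracketZr => /eqP.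
  rewrite !mulf_eq0 (negPf uv) /= /bracket !mulmx2E !mxE /=.
  by rewrite !mulr1 !mulr0 !addr0 sub0r oppr_eq0 => /eqP.
have := det_neq0 uN'; rewrite N'0 mulr0 subr0 mulf_eq0 negb_or => /andP[n00 n11].
exists M', (N' 0 0 / N' 1 1), (N' 0 1 / N' 1 1); split=> //.
  by rewrite mulf_neq0 ?invr_neq0.
apply: bir_affine_eq cF; exists [::] => y _ x; congr (_, _) => /=.
by rewrite /moebius N'0 mul0r add0r mulrDl mulrAC.
Qed.

(** A competitor [B'] containing the conjugate of [B] is conjugated back by [g^-1] into [Jonq],
    where maximality of [B] applies. *)
Lemma borel_conj_Jonq_Aff (B : set Bir) : is_borel (Jonq k) B ->
  exists2 g, Jonq_PGL2 k g & is_borel (Jonq_Aff k) (conj_subgroup g B).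
Proof.
move=> [ccsB BJ Bmax]; have [sB _ cB soB] := ccsB.
have [g gP gB] := connected_solvable_conj_Jonq_Aff sB cB soB BJ.
exists g => //; split=> //; first exact: conj_closed_connected_solvable.
move=> B' ccsB' B'J gBB'; rewrite -[LHS](conj_subgroupK g); congr conj_subgroup.
apply: Bmax.
- exact: conj_closed_connected_solvable.
- apply: conj_Jonq; first exact: Jonq_PGL2V.
  exact: subset_trans Jonq_Aff_sub.
- by rewrite -[X in X `<=` _](conj_subgroupVK g); exact: conj_subgroup_sub.
Qed.

End Jonquieres.

Theorem theorem4p1 (R : realType) :
  (forall G : set (Bir R[i]),
      closed_connected_solvable G -> G `<=` Jonq R[i] ->
      exists2 g, Jonq_PGL2 R[i] g & conj_subgroup g G `<=` Jonq_Aff R[i])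
  /\
  (forall B : set (Bir R[i]),
      is_borel (Jonq R[i]) B ->
      exists2 g, Jonq_PGL2 R[i] g &
        is_borel (Jonq_Aff R[i]) (conj_subgroup g B)).
Proof.
split=> [G [sG _ cG soG]|B]; last exact: borel_conj_Jonq_Aff.
exact: connected_solvable_conj_Jonq_Aff.
Qed.
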